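(* Let $\bar{\mathcal Q}$ and $\bar{\mathcal R}$ denote the results computed in floating-point arithmetic by the algorithm BCGSI+A-1S applied to $\mathcal X\in\mathbb R^{m\times ps}$ with intraorthogonalization routine $\mathrm{IO}_A$. Assume that for all $X\in\mathbb R^{m\times s}$ with $\kappa(X)\le\kappa(\mathcal X)$, the following hold for the computed $[\bar Q,\bar R]=\mathrm{IO}_A(X)$: $$X+\Delta X=\bar Q\bar R,\quad \|\Delta X\|\le O(\varepsilon)\|X\|,\qquad \|I-\bar Q^T\bar Q\|\le O(\varepsilon)\,\kappa^{\alpha_A}(X).$$ If $\alpha_A\le2$ and $O(\varepsilon)\,\kappa^{3}(\mathcal X)\le\frac12$ are satisfied, then $$\mathcal X+\Delta\mathcal X=\bar{\mathcal Q}\bar{\mathcal R},\quad\|\Delta\mathcal X\|\le O(\varepsilon)\|\mathcal X\|,$$ and $$\|I-\bar{\mathcal Q}^T\bar{\mathcal Q}\|\le O(\varepsilon)\,\kappa^2(\mathcal X).$$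
   Context: Conventions. $m,s,p$ are positive integers with $m\ge ps$; $\mathcal X=[X_1\ X_2\ \cdots\ X_p]\in\mathbb R^{m\times ps}$ with block vectors $X_k\in\mathbb R^{m\times s}$. $\|\cdot\|$ is the induced 2-norm and $\kappa(\cdot)$ is the 2-norm condition number (ratio of largest to smallest singular value); $\kappa^{\alpha}(X)=(\kappa(X))^\alpha$, with nonnegative real exponents. Computations are carried out in floating-point arithmetic (standard model) with unit roundoff $\varepsilon$, and bars denote computed quantities; batching matrix products is assumed to introduce only $O(\varepsilon)$ errors, as for ordinary matrix products. $O(\varepsilon)$ denotes a quantity bounded by $c\,\varepsilon$, where $c$ depends only on the dimensions $m,s,p$ and may differ at each occurrence; a hypothesis involving $O(\varepsilon)$ means that it holds with a suitable (sufficiently large) such constant. An intraorthogonalization routine $\mathrm{IO}_A$ takes $X\in\mathbb R^{m\times s}$ and returns $[Q,R]$, where in exact arithmetic $X=QR$, $Q\in\mathbb R^{m\times s}$, $Q^TQ=I$, and $R\in\mathbb R^{s\times s}$ is upper triangular. $\mathrm{chol}(A)$ returns the upper triangular Cholesky factor $Y$ with $A=Y^TY$. Notation. $\mathcal Q_k=[Q_1\ \cdots\ Q_k]$; $\mathcal R=(R_{ij})$, $\mathcal S=(S_{ij})$, $\mathcal Y=(Y_{ij})$ have $s\times s$ blocks; a subscript $1{:}j,k$ denotes the block column with block rows $1,\dots,j$ and block column $k$. Algorithm BCGSI+A-1S($\mathcal X,\mathrm{IO}_A$): $[Q_1,R_{11}]=\mathrm{IO}_A(X_1)$; $S_{12}=Q_1^TX_2$;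 $V_2=X_2-Q_1S_{12}$. For $k=2,\dots,p-1$: (i) $\begin{bmatrix}\mathcal Y_{1:k-1,k}&Z_{k-1}\\ \Omega_k&P_k\end{bmatrix}=[\mathcal Q_{k-1}\ V_k]^T[V_k\ X_{k+1}]$; (ii) $Y_{kk}=\mathrm{chol}(\Omega_k-\mathcal Y_{1:k-1,k}^T\mathcal Y_{1:k-1,k})$; (iii) $Q_k=(V_k-\mathcal Q_{k-1}\mathcal Y_{1:k-1,k})Y_{kk}^{-1}$; (iv) $\mathcal R_{1:k-1,k}=\mathcal S_{1:k-1,k}+\mathcal Y_{1:k-1,k}$, $R_{kk}=Y_{kk}$; (v) $\mathcal S_{1:k,k+1}=\begin{bmatrix}Z_{k-1}\\ Y_{kk}^{-T}(P_k-\mathcal Y_{1:k-1,k}^TZ_{k-1})\end{bmatrix}$; (vi) $V_{k+1}=X_{k+1}-\mathcal Q_k\mathcal S_{1:k,k+1}$. Finally: $\begin{bmatrix}\mathcal Y_{1:p-1,p}\\ \Omega_p\end{bmatrix}=[\mathcal Q_{p-1}\ V_p]^TV_p$; $Y_{pp}=\mathrm{chol}(\Omega_p-\mathcal Y_{1:p-1,p}^T\mathcal Y_{1:p-1,p})$; $Q_p=(V_p-\mathcal Q_{p-1}\mathcal Y_{1:p-1,p})Y_{pp}^{-1}$; $\mathcal R_{1:p-1,p}=\mathcal S_{1:p-1,p}+\mathcal Y_{1:p-1,p}$; $R_{pp}=Y_{pp}$. Return $\mathcal Q=[Q_1,\dots,Q_p]$ and $\mathcal R=(R_{ij})$. Multiplications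 by $Y_{kk}^{-1}$, $Y_{kk}^{-T}$ are computed by triangular solves. *)

(* Defs.v *)
From mathcomp Require Import all_boot all_order all_algebra.
From mathcomp Require Import all_classical all_reals all_analysis.

Set Implicit Arguments.
Unset Strict Implicit.
Unset Printing Implicit Defensive.

Import Order.TTheory GRing.Theory Num.Theory.

Local Open Scope classical_set_scope.
Local Open Scope ring_scope.

(* MathComp-Analysis, over an arbitrary R : realType. *)

(** * Induced 2-norm and 2-norm condition number *)

Section Norms.
Context {R : realType}.

(* The norm `|v| that the library puts on matrices is the max norm. *)
Definition norm2 n (v : 'cV[R]_n) : R := Num.sqrt (\sum_i v i 0 ^+ 2).

Definition opnorm2 m n (A : 'M[R]_(m, n)) : R :=
  sup [set norm2 (A *m x) / norm2 x | x in [set x : 'cV[R]_n | x != 0]].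

(* For n <= m, as everywhere below, these are the n singular values of A
   (without multiplicity). *)
Definition singular_values m n (A : 'M[R]_(m, n)) : set R :=
  [set sigma | 0 <= sigma /\ eigenvalue (A^T *m A) (sigma ^+ 2)].

Definition sigma_max m n (A : 'M[R]_(m, n)) : R := sup (singular_values A).
Definition sigma_min m n (A : 'M[R]_(m, n)) : R := inf (singular_values A).

(* +oo for a rank-deficient matrix; the real quotient would be x / 0 = 0. *)
Definition kappa m n (A : 'M[R]_(m, n)) : \bar R :=
  if sigma_min A == 0 then +oo%E else (sigma_max A / sigma_min A)%:E.

End Norms.

(** * Floating-point arithmetic

   The standard model is nondeterministic: an operation with exact result x may
   return any x (1 + d) with |d| <= eps.  Each predicate below relates exact
   inputs to every output that the model allows.  There is no overflow or
   underflow.  The square root of a negative number and the quotient by zero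
   may be any number, so that an execution that breaks down is not discarded:
   its results are arbitrary. *)

Section FloatingPoint.
Context {R : realType}.
Variable eps : R.

Definition fl_round (x y : R) : Prop :=
  exists d : R, `|d| <= eps /\ y = x * (1 + d).

Definition fl_div (x y z : R) : Prop := y != 0 -> fl_round (x / y) z.

Definition fl_sqrt (x z : R) : Prop := 0 <= x -> fl_round (Num.sqrt x) z.

(* Sum of a nonempty list in any order and with any parenthesization; both
   sublists in fl_sumD are nonempty since [::] has no computed sum. *)
Inductive fl_sum : seq R -> R -> Prop :=
| fl_sum1 x : fl_sum [:: x] x
| fl_sumD s s1 s2 x1 x2 x : perm_eq s (s1 ++ s2) ->
    fl_sum s1 x1 -> fl_sum s2 x2 -> fl_round (x1 + x2) x -> fl_sum s x.

(* z is the computed value of a - \sum_(l | D l) x l * y l. *)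
Definition fl_residual n (D : pred 'I_n) (a : R) (x y : 'I_n -> R) (z : R) :
    Prop :=
  exists t : 'I_n -> R,
    (forall l, D l -> fl_round (x l * y l) (t l)) /\
    fl_sum (a :: [seq - t l | l <- enum D]) z.

Definition fl_addmx m n (A B C : 'M[R]_(m, n)) : Prop :=
  forall i j, fl_round (A i j + B i j) (C i j).

Definition fl_mulmx m r n (A : 'M[R]_(m, r)) (B : 'M[R]_(r, n))
    (C : 'M[R]_(m, n)) : Prop :=
  forall i j, exists t : 'I_r -> R,
    (forall l, fl_round (A i l * B l j) (t l)) /\
    fl_sum [seq t l | l <- enum 'I_r] (C i j).

(* W is the computed C - A *m B. *)
Definition fl_submulmx m r n (C : 'M[R]_(m, n)) (A : 'M[R]_(m, r))
    (B : 'M[R]_(r, n)) (W : 'M[R]_(m, n)) : Prop :=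
  forall i j, fl_residual predT (C i j) (A i) (B^~ j) (W i j).

(* Y is the computed upper triangular Cholesky factor, A = Y^T *m Y; only the
   upper triangle of A is referenced. *)
Definition fl_chol n (A Y : 'M[R]_n) : Prop :=
  [/\ forall i j : 'I_n, (j < i)%N -> Y i j = 0,
      forall i j : 'I_n, (i < j)%N ->
        exists2 w, fl_residual [pred l : 'I_n | (l < i)%N] (A i j)
                     (Y^~ i) (Y^~ j) w
                 & fl_div w (Y i i) (Y i j)
    & forall j : 'I_n,
        exists2 w, fl_residual [pred l : 'I_n | (l < j)%N] (A j j)
                     (Y^~ j) (Y^~ j) w
                 & fl_sqrt w (Y j j)].

(* T is the computed W *m Y^-1, Y upper triangular: substitution in
   T *m Y = W. *)
Definition fl_trsm m n (W : 'M[R]_(m, n)) (Y : 'M[R]_n) (T : 'M[R]_(m, n)) :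
    Prop :=
  forall (i : 'I_m) (j : 'I_n),
    exists2 w, fl_residual [pred l : 'I_n | (l < j)%N] (W i j) (T i) (Y^~ j) w
             & fl_div w (Y j j) (T i j).

(* C is a computed A^T *m B that is one block of a batched product; the
   batching is only known to commit an error O(eps), with constant cB. *)
Definition fl_batch (cB : R) m a b (A : 'M[R]_(m, a)) (B : 'M[R]_(m, b))
    (C : 'M[R]_(a, b)) : Prop :=
  opnorm2 (C - A^T *m B) <= cB * eps * opnorm2 A * opnorm2 B.

End FloatingPoint.

(** * BCGSI+A-1S

   Blocks are numbered from 0.  Families of blocks are functions on nat, of
   which only the entries with indices below p matter. *)

Section BCGSI.
Context {R : realType}.
Variables m s : nat.

Definition brow k (Q : nat -> 'M[R]_(m, s)) : 'M[R]_(m, \sum_(j < k) s) :=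
  \mxrow_(j < k) Q j.

Definition bcol k (S : nat -> nat -> 'M[R]_s) j : 'M[R]_(\sum_(i < k) s, s) :=
  \mxcol_(i < k) S i j.

Definition bmx p (S : nat -> nat -> 'M[R]_s) :
    'M[R]_(\sum_(i < p) s, \sum_(j < p) s) :=
  \mxblock_(i < p, j < p) S i j.

Variables (eps cB : R) (IOA : 'M[R]_(m, s) -> 'M[R]_(m, s) * 'M[R]_s).

(* The second orthogonalization of block k: steps (ii)-(iv) of the loop, and
   also the corresponding steps after the loop. *)
Definition reorthogonalize k (V : nat -> 'M[R]_(m, s))
    (Omega : nat -> 'M[R]_s) (S Y : nat -> nat -> 'M[R]_s)
    (Q : nat -> 'M[R]_(m, s)) (Rb : nat -> nat -> 'M[R]_s) : Prop :=
  [/\ exists2 G, fl_submulmx eps (Omega k) (bcol k Y k)^T (bcol k Y k) G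
               & fl_chol eps G (Y k k),
      exists2 W, fl_submulmx eps (V k) (brow k Q) (bcol k Y k) W
               & fl_trsm eps W (Y k k) (Q k),
      fl_addmx eps (bcol k S k) (bcol k Y k) (bcol k Rb k)
    & Rb k k = Y k k].

(* brow p Q and bmx p Rb are computed from brow p X.  For p = 1 there is no X_2
   and the result is that of IOA. *)
Definition bcgsiA1S p (X Q : nat -> 'M[R]_(m, s)) (Rb : nat -> nat -> 'M[R]_s) :
    Prop :=
  exists (V : nat -> 'M[R]_(m, s)) (Omega P : nat -> 'M[R]_s)
    (S Y : nat -> nat -> 'M[R]_s)
    (Z : forall k, 'M[R]_(\sum_(i < k) s, s)),
  [/\ IOA (X 0%N) = (Q 0%N, Rb 0%N 0%N),
      (1 < p)%N ->
        fl_mulmx eps (Q 0%N)^T (X 1%N) (S 0%N 1%N) /\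
        fl_submulmx eps (X 1%N) (Q 0%N) (S 0%N 1%N) (V 1%N),
      forall k, (0 < k)%N -> (k.+1 < p)%N ->
        [/\ [/\ fl_batch eps cB (brow k Q) (V k) (bcol k Y k),
                fl_batch eps cB (brow k Q) (X k.+1) (Z k),
                fl_batch eps cB (V k) (V k) (Omega k)
              & fl_batch eps cB (V k) (X k.+1) (P k)],
            reorthogonalize k V Omega S Y Q Rb,
            bcol k S k.+1 = Z k
              /\ (exists2 G, fl_submulmx eps (P k) (bcol k Y k)^T (Z k) G
                           & fl_trsm eps G^T (Y k k) (S k k.+1)^T)
          & fl_submulmx eps (X k.+1) (brow k.+1 Q) (bcol k.+1 S k.+1)
              (V k.+1)],
      forall k, (0 < k)%N -> k.+1 = p ->
        [/\ fl_batch eps cB (brow k Q) (V k) (bcol k Y k),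
            fl_batch eps cB (V k) (V k) (Omega k)
          & reorthogonalize k V Omega S Y Q Rb]
    & forall i j, (j < i < p)%N -> Rb i j = 0].

End BCGSI.

(* Main.v *)
(* Write eps for the unit roundoff, M for |X| and sg for the least singular
   value of X, so that kappa = M / sg.  By induction on k, the computed blocks
   satisfy, up to constants depending on the dimensions only,
     Q_i^T Q_j - delta_ij I = O(eps kappa^2),
     X_j - sum_(i <= j) Q_i R_ij = O(eps M).
   At step k, let A be the matrix of the previous Q_i.  The first pass returns
   V = X_k - A S up to O(eps M) with S = A^T X_k up to O(eps kappa M), so that
   A^T V = O(eps kappa^2 M), which is O(sg) since eps kappa^3 is small.  The
   second pass computes W = V - A Y with Y = A^T V up to O(eps M): hence
   A^T W = O(eps kappa M) and, by the Pythagorean identity,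
   W^T W = V^T V - Y^T Y up to O(eps M^2).  Since the previous X_j are
   combinations of the Q_i with an invertible R, up to O(eps M), W x is a
   combination of the columns of X with a coefficient vector of norm at least
   |x|, so that |W x| >= sg |x| / 2.  Therefore the Cholesky factorization of
   the computed V^T V - Y^T Y does not break down, its factor U satisfies
   U^T U = W^T W + O(eps M^2) and U^-1 = O(1 / sg), and Q_k = W U^-1 inherits
   Q_k^T Q_k - I = O(eps kappa^2) and A^T Q_k = O(eps kappa^2). *)

Require Import Defs.
From mathcomp Require Import all_boot all_order all_algebra.
From mathcomp Require Import all_classical all_reals all_analysis.
From mathcomp Require Import ring lra.

Set Implicit Arguments.
Unset Strict Implicit.
Unset Printing Implicit Defensive.

Import Order.TTheory GRing.Theory Num.Theory.

Local Open Scope classical_set_scope.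
Local Open Scope ring_scope.

(** * Norms *)

(** The O(eps) calculus uses domination along a filter on the type of all runs with fixed dimensions
    and fixed input constants. Each bound is one constant valid on a set of the filter, so the final
    constants cannot depend on eps or on the matrices. Errors are measured in the max norm; passing
    to and from the 2-norm only costs factors of the dimensions.

    Why the cube is the right power: the first pass leaves A^T V of size eps kappa^2 M, and eps
    kappa^3 <= 1 says exactly that this scale is at most sg. Hence the correction Y is O(sg).
    Multiplied by the defect A^T A - I = O(eps kappa^2), one factor Y gives eps kappa M and two
    factors give eps M^2. After multiplication by U^-1, respectively by U^-1 on both sides, each
    becomes eps kappa^2.

    An execution that breaks down has arbitrary results. So in the Cholesky analysis a pivot must be
    shown positive before anything is known about the entries that depend on it, which forces an
    induction over entries. *)

Section MaxNorm.
Context {R : realType}.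

Lemma mx_norm_coef m n (A : 'M[R]_(m, n)) i j : `|A i j| <= `|A|.
Proof.
rewrite -[leRHS]/(mx_norm A) mx_normrE.
exact: (le_bigmax _ (fun ij : 'I_m * 'I_n => `|A ij.1 ij.2|) (i, j)).
Qed.

Lemma mx_norm_le m n (A : 'M[R]_(m, n)) (c : R) :
  0 <= c -> (forall i j, `|A i j| <= c) -> `|A| <= c.
Proof.
move=> c0 Ac; rewrite -[leLHS]/(mx_norm A) mx_normrE.
by apply/bigmax_leP; split => // -[i j] _; exact: Ac.
Qed.

Lemma mx_norm_mul m n r (A : 'M[R]_(m, n)) (B : 'M[R]_(n, r)) :
  `|A *m B| <= n%:R * `|A| * `|B|.
Proof.
apply: mx_norm_le => [|i j]; first by rewrite !mulr_ge0.
rewrite mxE (le_trans (ler_norm_sum _ _ _))//.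
rewrite (le_trans (ler_sum _ (G := fun=> `|A| * `|B|) _))//.
  by move=> k _; rewrite normrM ler_pM ?mx_norm_coef.
by rewrite sumr_const card_ord mulr_natl mulrnAl.
Qed.

Lemma mx_norm_tr m n (A : 'M[R]_(m, n)) : `|A^T| = `|A|.
Proof.
apply/eqP; rewrite eq_le; apply/andP; split; apply: mx_norm_le => // i j.
  by rewrite mxE mx_norm_coef.
by rewrite (_ : A i j = A^T j i) ?mx_norm_coef// mxE.
Qed.

(** Diagonal entries of A^T A are sums of squares of columns. This is how a matrix is later bounded
    through its Gram matrix. *)
Lemma mx_norm_sqr m n (A : 'M[R]_(m, n)) : `|A| ^+ 2 <= `|A^T *m A|.
Proof.
rewrite -(@sqr_sqrtr _ `|A^T *m A|)// ler_pXn2r ?nnegrE ?sqrtr_ge0//.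
apply: mx_norm_le => [|i j]; first exact: sqrtr_ge0.
rewrite -sqrtr_sqr ler_wsqrtr//.
apply: le_trans (mx_norm_coef _ j j); rewrite (le_trans _ (ler_norm _))//.
rewrite mxE (bigD1 i)//= mxE -expr2 lerDl sumr_ge0// => k _.
by rewrite mxE -expr2 sqr_ge0.
Qed.

Lemma norm2_ge0 n (v : 'cV[R]_n) : 0 <= norm2 v.
Proof. exact: sqrtr_ge0. Qed.

Lemma sqr_norm2 n (v : 'cV[R]_n) : norm2 v ^+ 2 = (v^T *m v) 0 0.
Proof.
rewrite sqr_sqrtr ?sumr_ge0// => [|i _]; last exact: sqr_ge0.
by rewrite mxE; apply: eq_bigr => i _; rewrite mxE expr2.
Qed.

Lemma mx_norm_le_norm2 n (v : 'cV[R]_n) : `|v| <= norm2 v.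
Proof.
rewrite -(@ler_pXn2r _ 2)// ?nnegrE ?norm2_ge0//.
apply: le_trans (mx_norm_sqr v) _; rewrite sqr_norm2.
apply: mx_norm_le => [|i j]; first by rewrite -sqr_norm2 sqr_ge0.
by rewrite !ord1 ger0_norm// -sqr_norm2 sqr_ge0.
Qed.

Lemma norm2_le_mx_norm n (v : 'cV[R]_n) : norm2 v <= n%:R * `|v|.
Proof.
rewrite -(@ler_pXn2r _ 2)// ?nnegrE ?norm2_ge0 ?mulr_ge0//.
rewrite sqr_norm2 (le_trans (ler_norm _))// (le_trans (mx_norm_coef _ _ _))//.
rewrite (le_trans (mx_norm_mul _ _))// mx_norm_tr exprMn -mulrA -expr2.
rewrite ler_wpM2r ?sqr_ge0// -natrX ler_nat.
by case: n v => // n _; rewrite -mulnn leq_pmulr.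
Qed.

Lemma norm2_eq0 n (v : 'cV[R]_n) : (norm2 v == 0) = (v == 0).
Proof.
apply/eqP/eqP => [v0|->].
  by apply/eqP; rewrite -normr_eq0 eq_le normr_ge0 -v0 mx_norm_le_norm2.
apply/eqP; rewrite eq_le norm2_ge0 andbT.
by rewrite (le_trans (norm2_le_mx_norm _))// normr0 mulr0.
Qed.

Lemma norm2_gt0 n (v : 'cV[R]_n) : (0 < norm2 v) = (v != 0).
Proof. by rewrite lt_def norm2_ge0 andbT norm2_eq0. Qed.

Lemma mx_norm_quad n (A : 'M[R]_n) (x : 'cV[R]_n) :
  `|(x^T *m A *m x) 0 0| <= n%:R ^+ 2 * `|A| * `|x| ^+ 2.
Proof.
apply: le_trans (mx_norm_coef _ _ _) _; apply: le_trans (mx_norm_mul _ _) _.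
rewrite expr2 -!mulrA ler_wpM2l// mulrC.
have := mx_norm_mul x^T A; rewrite mx_norm_tr => xA.
apply: le_trans (ler_wpM2l _ xA) _ => //.
lra.
Qed.

End MaxNorm.

Section OperatorNorm.
Context {R : realType}.

Lemma norm2_mul_le m n (A : 'M[R]_(m, n)) (x : 'cV[R]_n) :
  norm2 (A *m x) <= m%:R * n%:R * `|A| * norm2 x.
Proof.
apply: le_trans (norm2_le_mx_norm _) _; rewrite -!mulrA ler_wpM2l//.
rewrite mulrA (le_trans (mx_norm_mul _ _))// ler_wpM2l ?mulr_ge0//.
exact: mx_norm_le_norm2.
Qed.

Lemma norm2_mul_opnorm2 m n (A : 'M[R]_(m, n)) (x : 'cV[R]_n) :
  norm2 (A *m x) <= opnorm2 A * norm2 x.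
Proof.
have [->|x0] := eqVneq x 0.
  by have /eqP-> : norm2 (A *m 0) == 0; rewrite ?norm2_eq0 ?mulmx0//;
     have /eqP-> : norm2 (0 : 'cV[R]_n) == 0; rewrite ?norm2_eq0 ?mulr0.
rewrite -ler_pdivrMr ?norm2_gt0//; apply: ub_le_sup; last by exists x.
exists (m%:R * n%:R * `|A|) => _ [y /= y0 <-].
by rewrite ler_pdivrMr ?norm2_gt0// norm2_mul_le.
Qed.

(** The sign condition covers [n = 0], where the set is empty and its [sup] is 0. *)
Lemma opnorm2_le m n (A : 'M[R]_(m, n)) (c : R) : 0 <= c ->
  (forall x, norm2 (A *m x) <= c * norm2 x) -> opnorm2 A <= c.
Proof.
move=> c0 Ac; rewrite /opnorm2; set E := [set _ | _ in _].
have [->|/set0P[e Ee]] := eqVneq E set0; first by rewrite sup0.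
apply: ge_sup; first by exists e.
by move=> _ [x /= x0 <-]; rewrite ler_pdivrMr ?norm2_gt0.
Qed.

Lemma opnorm2_ge0 m n (A : 'M[R]_(m, n)) : 0 <= opnorm2 A.
Proof.
rewrite /opnorm2; set E := [set _ | _ in _].
have [->|/set0P[_ [x /= x0 _]]] := eqVneq E set0; first by rewrite sup0.
rewrite -(@pmulr_lge0 _ (norm2 x)) ?norm2_gt0//.
exact: le_trans (norm2_ge0 _) (norm2_mul_opnorm2 A x).
Qed.

Lemma opnorm2_le_mx_norm m n (A : 'M[R]_(m, n)) :
  opnorm2 A <= m%:R * n%:R * `|A|.
Proof. by apply: opnorm2_le => [|x]; rewrite ?mulr_ge0 ?norm2_mul_le. Qed.

Lemma mx_norm_le_opnorm2 m n (A : 'M[R]_(m, n)) : `|A| <= opnorm2 A.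
Proof.
have coef i j : `|A i j| <= opnorm2 A.
  have /(_ (delta_mx j 0)) := norm2_mul_opnorm2 A.
  have -> : norm2 (delta_mx j 0 : 'cV[R]_n) = 1.
    rewrite /norm2 (bigD1 j)//= big1 => [|k /negbTE kj].
      by rewrite mxE !eqxx expr1n addr0 sqrtr1.
    by rewrite mxE kj expr0n.
  rewrite mulr1 -colE; apply: le_trans.
  by apply/le_trans/mx_norm_le_norm2; rewrite (_ : A i j = col j A i 0) ?mx_norm_coef// mxE.
case: m A coef => [|m] A coef.
  have -> : A = 0 by apply/matrixP => -[].
  by rewrite normr0 opnorm2_ge0.
case: n A coef => [|n] A coef.
  have -> : A = 0 by apply/matrixP => ? [].
  by rewrite normr0 opnorm2_ge0.
by apply: mx_norm_le => //; apply: le_trans (coef 0 0).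
Qed.

End OperatorNorm.

(** * Singular values *)

Section Spectral.
Context {R : realType}.
Implicit Types n : nat.

Let quad n (A : 'M[R]_n) (x : 'cV[R]_n) : R := (x^T *m A *m x) 0 0.

Let quad_le n (A : 'M[R]_n) x : `|quad A x| <= n%:R ^+ 2 * `|A| * norm2 x ^+ 2.
Proof.
apply: le_trans (mx_norm_quad A x) _; rewrite ler_wpM2l ?mulr_ge0 ?sqr_ge0//.
by rewrite ler_pXn2r ?nnegrE ?norm2_ge0// mx_norm_le_norm2.
Qed.

(* With y = B^-1 x, expanding 0 <= quad B (x - t y) at t = 1 / K, where K
   bounds the quadratic form of B^-1, gives quad B x >= |x|^2 / K. *)
Lemma psd_unit_gap n (B : 'M[R]_n) : B^T = B -> B \in unitmx ->
  (forall x, 0 <= quad B x) ->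
  exists2 c, 0 < c & forall x, c * norm2 x ^+ 2 <= quad B x.
Proof.
move=> Bsym Bu Bpsd; pose K := n%:R ^+ 2 * `|invmx B| + 1.
have K0 : 0 < K by rewrite ltr_wpDl// mulr_ge0.
exists K^-1; rewrite ?invr_gt0// => x.
pose y := invmx B *m x.
have xB : x^T = y^T *m B by rewrite trmx_mul trmx_inv Bsym mulmxKV.
have By : B *m y = x by rewrite mulKVmx.
have yBy : quad B y <= K * norm2 x ^+ 2.
  have -> : quad B y = quad (invmx B) x by rewrite /quad -xB mulmxA.
  apply: le_trans (ler_norm _) _; apply: le_trans (quad_le _ _) _.
  by rewrite ler_wpM2r ?sqr_ge0// lerDl.
have xBy : (x^T *m B *m y) 0 0 = norm2 x ^+ 2 by rewrite sqr_norm2 -mulmxA By.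
have yBx : (y^T *m B *m x) 0 0 = norm2 x ^+ 2 by rewrite sqr_norm2 -xB.
have := Bpsd (x - K^-1 *: y).
have -> : quad B (x - K^-1 *: y) = quad B x - 2 * K^-1 * norm2 x ^+ 2 + K^-1 ^+ 2 * quad B y.
  rewrite /quad (_ : (x - K^-1 *: y)^T = x^T - K^-1 *: y^T); last first.
    by rewrite linearB linearZ.
  rewrite !(mulmxBl, mulmxBr) -!(scalemxAl, scalemxAr).
  have subE (M N : 'M[R]_1) : (M - N) 0 0 = M 0 0 - N 0 0 by rewrite !mxE.
  have scaleE a (M : 'M[R]_1) : (a *: M) 0 0 = a * M 0 0 by rewrite mxE.
  rewrite !(subE, scaleE) xBy yBx /quad; ring.
have : K^-1 ^+ 2 * quad B y <= K^-1 * norm2 x ^+ 2.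
  rewrite expr2 -mulrA ler_pM2l ?invr_gt0// mulrC ler_pdivrMr//.
  by rewrite mulrC.
lra.
Qed.

(** If A - l were invertible for the infimum l of the Rayleigh quotient, [psd_unit_gap] would
    improve the lower bound to l + c with c > 0. This takes the place of a compactness argument on
    the sphere. *)
Lemma rayleigh_min n (A : 'M[R]_n) : (0 < n)%N -> A^T = A ->
  exists2 l, eigenvalue A l & forall x, l * norm2 x ^+ 2 <= quad A x.
Proof.
move=> n0 Asym.
pose E := [set quad A x / norm2 x ^+ 2 | x in [set x : 'cV[R]_n | x != 0]].
have EE : has_inf E.
  split.
    exists (quad A (const_mx 1) / norm2 (const_mx 1 : 'cV[R]_n) ^+ 2), (const_mx 1) => //=.
    by apply/eqP => /matrixP/(_ (Ordinal n0) 0)/eqP; rewrite !mxE oner_eq0.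
  exists (- (n%:R ^+ 2 * `|A|)) => _ [x /= x0 <-].
  rewrite ler_pdivlMr ?exprn_gt0 ?norm2_gt0// mulNr.
  by have := quad_le A x; rewrite ler_norml => /andP[].
pose l := inf E; pose B := A - l%:M.
have quadB x : quad B x = quad A x - l * norm2 x ^+ 2.
  rewrite /quad mulmxBr mulmxBl mul_mx_scalar -scalemxAl sqr_norm2.
  have subE (M N : 'M[R]_1) : (M - N) 0 0 = M 0 0 - N 0 0 by rewrite !mxE.
  by rewrite subE [X in _ - X]mxE.
have lP x : l * norm2 x ^+ 2 <= quad A x.
  have [->|x0] := eqVneq x 0.
    have /eqP-> : norm2 (0 : 'cV[R]_n) == 0 by rewrite norm2_eq0.
    by rewrite /quad mulmx0 mxE expr0n mulr0.
  rewrite -ler_pdivlMr ?exprn_gt0 ?norm2_gt0//.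
  by apply: ge_inf; [exact: EE.2 | exists x].
exists l => //.
have : B \notin unitmx.
  apply/negP => Bu.
  have [||c c0 Bc] := psd_unit_gap _ Bu.
  - by rewrite linearB/= Asym tr_scalar_mx.
  - by move=> x; rewrite quadB subr_ge0.
  have : l + c <= l.
    apply: lb_le_inf; first exact: EE.1.
    move=> _ [x /= x0 <-]; rewrite ler_pdivlMr ?exprn_gt0 ?norm2_gt0//.
    by have := Bc x; rewrite quadB; lra.
  by lra.
rewrite -row_free_unit -kermx_eq0 => /rowV0Pn[v /sub_kermxP vB v0].
apply/eigenvalueP; exists v => //.
by apply/eqP; rewrite -subr_eq0 -mul_mx_scalar -mulmxBr vB.
Qed.

Lemma quad_gram m n (A : 'M[R]_(m, n)) x : quad (A^T *m A) x = norm2 (A *m x) ^+ 2.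
Proof. by rewrite sqr_norm2 trmx_mul /quad !mulmxA. Qed.

Lemma eigenvalue_gram m n (A : 'M[R]_(m, n)) l : eigenvalue (A^T *m A) l ->
  exists2 x, x != 0 & norm2 (A *m x) ^+ 2 = l * norm2 x ^+ 2.
Proof.
move=> /eigenvalueP[v vA v0]; exists v^T; first by rewrite trmx_eq0.
rewrite -quad_gram /quad trmxK vA -scalemxAl mxE sqr_norm2 trmxK.
by [].
Qed.

Lemma singular_value_vector m n (A : 'M[R]_(m, n)) t : singular_values A t ->
  exists2 x, x != 0 & norm2 (A *m x) = t * norm2 x.
Proof.
move=> [t0 /eigenvalue_gram[x x0 Ax]]; exists x => //.
by apply: (@pexpIrn _ 2) => //; rewrite ?nnegrE ?mulr_ge0 ?norm2_ge0// exprMn.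
Qed.

Lemma singular_value_of_eigenvalue m n (A : 'M[R]_(m, n)) l :
  eigenvalue (A^T *m A) l -> 0 <= l /\ singular_values A (Num.sqrt l).
Proof.
move=> Al; suff l0 : 0 <= l.
  by split=> //; split; rewrite ?sqrtr_ge0 ?sqr_sqrtr.
have [x x0 Ax] := eigenvalue_gram Al.
by rewrite -(@pmulr_lge0 _ (norm2 x ^+ 2)) ?exprn_gt0 ?norm2_gt0// -Ax sqr_ge0.
Qed.

Lemma min_singular_value m n (A : 'M[R]_(m, n)) : (0 < n)%N ->
  exists2 t, singular_values A t & forall x, t * norm2 x <= norm2 (A *m x).
Proof.
move=> n0; have [|l Al lP] := @rayleigh_min _ (A^T *m A) n0.
  by rewrite trmx_mul trmxK.
have [l0 tA] := singular_value_of_eigenvalue Al.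
exists (Num.sqrt l) => // x.
rewrite -(@ler_pXn2r _ 2)// ?nnegrE ?mulr_ge0 ?sqrtr_ge0 ?norm2_ge0//.
by rewrite exprMn sqr_sqrtr// -quad_gram.
Qed.

Lemma max_singular_value m n (A : 'M[R]_(m, n)) : (0 < n)%N ->
  exists2 t, singular_values A t & forall x, norm2 (A *m x) <= t * norm2 x.
Proof.
(* The largest eigenvalue of the Gram matrix is minus the least one of its negative. *)
move=> n0; have [|l /eigenvalueP[v Av v0] lP] := @rayleigh_min _ (- (A^T *m A)) n0.
  by rewrite linearN/= trmx_mul trmxK.
have Al : eigenvalue (A^T *m A) (- l).
  by apply/eigenvalueP; exists v => //; rewrite scaleNr -Av mulmxN opprK.
have [l0 tA] := singular_value_of_eigenvalue Al.
exists (Num.sqrt (- l)) => // x.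
rewrite -(@ler_pXn2r _ 2)// ?nnegrE ?mulr_ge0 ?sqrtr_ge0 ?norm2_ge0//.
rewrite exprMn (@sqr_sqrtr _ (- l))// -quad_gram mulNr lerNr (le_trans (lP x))//.
by rewrite /quad mulmxN mulNmx mxE.
Qed.

Section ConditionNumber.
Variables (m n : nat) (A : 'M[R]_(m, n)).
Hypothesis n_gt0 : (0 < n)%N.

Lemma sigma_min_ge0 : 0 <= sigma_min A.
Proof.
have [t At _] := min_singular_value A n_gt0.
by apply: lb_le_inf; [exists t|move=> u []].
Qed.

Lemma sigma_min_le x : sigma_min A * norm2 x <= norm2 (A *m x).
Proof.
have [t At tP] := min_singular_value A n_gt0.
apply: le_trans (tP x); rewrite ler_wpM2r ?norm2_ge0//.
by apply: ge_inf => //; exists 0 => u [].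
Qed.

Lemma le_sigma_min c : (forall x, c * norm2 x <= norm2 (A *m x)) ->
  c <= sigma_min A.
Proof.
move=> Ac; have [t At tP] := min_singular_value A n_gt0.
apply: lb_le_inf; first by exists t.
move=> u /singular_value_vector[x x0 Ax].
by have := Ac x; rewrite Ax ler_pM2r ?norm2_gt0.
Qed.

Lemma sigma_maxE : sigma_max A = opnorm2 A.
Proof.
have svub : ubound (singular_values A) (opnorm2 A).
  move=> u /singular_value_vector[x x0 Ax].
  by rewrite -(ler_pM2r (x := norm2 x)) ?norm2_gt0// -Ax norm2_mul_opnorm2.
have [t At tP] := max_singular_value A n_gt0.
apply/eqP; rewrite eq_le; apply/andP; split; first by apply: ge_sup => //; exists t.
have tsup : t <= sigma_max A by apply: ub_le_sup => //; exists (opnorm2 A).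
apply: opnorm2_le => [|x]; first by apply: le_trans tsup; case: At.
by rewrite (le_trans (tP x))// ler_wpM2r ?norm2_ge0.
Qed.

Lemma kappaE : kappa A =
  if sigma_min A == 0 then +oo%E else (opnorm2 A / sigma_min A)%:E.
Proof. by rewrite /kappa sigma_maxE. Qed.

Lemma sigma_min_le_opnorm2 : sigma_min A <= opnorm2 A.
Proof.
have [t At tP] := min_singular_value A n_gt0.
have [x x0 _] := singular_value_vector At.
rewrite -(ler_pM2r (x := norm2 x)) ?norm2_gt0//.
exact: le_trans (sigma_min_le x) (norm2_mul_opnorm2 A x).
Qed.

End ConditionNumber.
End Spectral.

(** * Rounding errors *)

Section RoundingErrors.
Context {R : realType}.
Variable eps : R.
Hypotheses (eps_ge0 : 0 <= eps) (eps_le1 : eps <= 1).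

Lemma fl_round_error x y : fl_round eps x y -> `|y - x| <= eps * `|x|.
Proof.
move=> [d [de ->]]; rewrite (_ : _ - x = d * x); last by ring.
by rewrite normrM ler_wpM2r.
Qed.

(* For eps <= 1, 2^n - 1 bounds ((1 + eps)^n - 1) / eps. *)
Lemma fl_sum_error s x : fl_sum eps s x -> (0 < size s)%N /\
  `|x - \sum_(y <- s) y| <= (2 ^+ size s - 1) * eps * \sum_(y <- s) `|y|.
Proof.
elim=> {s x} [x|s s1 s2 x1 x2 x s12 _ [n1 e1] _ [n2 e2] /fl_round_error e].
  split=> //; rewrite !big_seq1 subrr normr0 !mulr_ge0// expr1.
  by rewrite subr_ge0 ler1n.
rewrite !(perm_big _ s12)/= (perm_size s12) !big_cat size_cat/=.
move: e1 e2; set a := size s1; set b := size s2.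
set S1 := \sum_(y <- s1) `|y|; set S2 := \sum_(y <- s2) `|y|.
set T1 := \sum_(y <- s1) y; set T2 := \sum_(y <- s2) y => e1 e2.
split; first by rewrite addn_gt0 n1.
have S10 : 0 <= S1 by apply: sumr_ge0.
have S20 : 0 <= S2 by apply: sumr_ge0.
have TS1 : `|T1| <= S1 by apply: ler_norm_sum.
have TS2 : `|T2| <= S2 by apply: ler_norm_sum.
(* Both sublists are nonempty, so a and b are at most a + b - 1 and K serves for both. The last
   addition turns K into 2 K + 1, the constant for a + b. *)
pose K : R := 2 ^+ (a + b).-1 - 1.
have abE : (a + b = (a + b).-1.+1)%N by rewrite prednK// addn_gt0 n1.
have KE : 2 ^+ (a + b) - 1 = 2 * K + 1 :> R by rewrite /K abE exprS/=; ring.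
have aK : 2 ^+ a - 1 <= K.
  by rewrite lerD2r ler_eXn2l ?ltr1n// -ltnS -abE -addn1 leq_add2l.
have bK : 2 ^+ b - 1 <= K.
  by rewrite lerD2r ler_eXn2l ?ltr1n// -ltnS -abE addnC -addn1 leq_add2l.
have {}e1 : `|x1 - T1| <= K * (eps * S1).
  by apply: le_trans e1 _; rewrite -mulrA ler_wpM2r// mulr_ge0.
have {}e2 : `|x2 - T2| <= K * (eps * S2).
  by apply: le_trans e2 _; rewrite -mulrA ler_wpM2r// mulr_ge0.
have K0 : 0 <= K by rewrite subr_ge0 exprn_ege1// ler1n.
set e0 := `|x1 - T1| + `|x2 - T2|.
have e0K : e0 <= K * (eps * (S1 + S2)) by rewrite /e0; lra.
have e00 : 0 <= e0 by rewrite addr_ge0.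
have x12 : `|x1 + x2| <= e0 + (S1 + S2).
  rewrite (_ : x1 + x2 = (x1 - T1) + (x2 - T2) + (T1 + T2)); last by ring.
  apply: le_trans (ler_normD _ _) _; apply: lerD; first exact: ler_normD.
  by apply: le_trans (ler_normD _ _) _; exact: lerD.
have -> : x - (T1 + T2) = (x - (x1 + x2)) + ((x1 - T1) + (x2 - T2)) by ring.
apply: le_trans (ler_normD _ _) _.
apply: le_trans (lerD e (ler_normD _ _)) _; rewrite -/e0 KE.
have : eps * `|x1 + x2| <= e0 + eps * (S1 + S2).
  apply: le_trans (ler_wpM2l eps_ge0 x12) _; rewrite mulrDr lerD2r.
  by rewrite -[leRHS]mul1r ler_wpM2r.
lra.
Qed.

Lemma fl_residual_error n (D : pred 'I_n) a (x y : 'I_n -> R) z :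
  fl_residual eps D a x y z ->
  `|z - (a - \sum_(l | D l) x l * y l)| <=
    2 ^+ n.+3 * eps * (`|a| + \sum_(l | D l) `|x l * y l|).
Proof.
move=> [t [tP /fl_sum_error[_]]].
rewrite !big_cons !big_map !big_enum/= size_map -cardE.
set k := #|_|; set S := \sum_(l | D l) `|x l * y l|.
under [X in _ * (_ + X)]eq_bigr do rewrite normrN.
rewrite sumrN.
set St := \sum_(l | D l) `|t l|.
have S0 : 0 <= S by apply: sumr_ge0.
have tS : St <= 2 * S.
  rewrite mulr_sumr; apply: ler_sum => l /tP/fl_round_error tl.
  rewrite (_ : t l = (t l - x l * y l) + x l * y l); last by ring.
  apply: le_trans (ler_normD _ _) _; rewrite (_ : 2 = 1 + 1 :> R)// mulrDl mul1r.
  by rewrite lerD2r (le_trans tl)// -[leRHS]mul1r ler_wpM2r.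
have txy : `|\sum_(l | D l) t l - \sum_(l | D l) x l * y l| <= eps * S.
  rewrite -sumrB (le_trans (ler_norm_sum _ _ _))// mulr_sumr.
  by apply: ler_sum => l /tP/fl_round_error.
move=> zt.
have kn : 2 ^+ k.+1 - 1 <= 2 ^+ n.+1 - 1 :> R.
  by rewrite lerD2r ler_eXn2l ?ltr1n// ltnS -[n in leqRHS]card_ord max_card.
have K1 : 1 <= 2 ^+ n :> R by rewrite exprn_ege1// ler1n.
have {}zt : `|z - (a - \sum_(l | D l) t l)| <=
    (2 ^+ n.+1 - 1) * (eps * (`|a| + 2 * S)).
  apply: le_trans zt _; rewrite -mulrA ler_pM//.
  - by rewrite subr_ge0 exprn_ege1// ler1n.
  - by rewrite mulr_ge0// addr_ge0// sumr_ge0.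
  - by rewrite ler_wpM2l// lerD2l.
rewrite (_ : z - _ = (z - (a - \sum_(l | D l) t l))
    - (\sum_(l | D l) t l - \sum_(l | D l) x l * y l)); last by ring.
apply: le_trans (ler_normB _ _) _.
apply: le_trans (lerD zt txy) _.
have a0 : 0 <= `|a| by [].
move: (`|a|) a0 => b b0; rewrite !exprS -!mulrA.
have := mulr_ge0 eps_ge0 b0; have := mulr_ge0 eps_ge0 S0.
move: (2 ^+ n) K1 => K K1 eS eb.
have := mulr_ge0 (le_trans ler01 K1) eS; have := mulr_ge0 (le_trans ler01 K1) eb.
lra.
Qed.

(** The error is measured after multiplication by d, so a small divisor does not enter the bound. *)
Lemma fl_residual_div_error n (D : pred 'I_n) a (x y : 'I_n -> R) w d z :
  d != 0 -> fl_residual eps D a x y w -> fl_div eps w d z ->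
  `|d * z - (a - \sum_(l | D l) x l * y l)| <=
    2 ^+ n.+1.+4 * eps * (`|a| + \sum_(l | D l) `|x l * y l|).
Proof.
move=> d0 /fl_residual_error wa /(_ d0)[e [e1 ->]].
set S := \sum_(l | D l) `|x l * y l| in wa *.
have S0 : 0 <= S by apply: sumr_ge0.
set r := a - _ in wa *; have rS : `|r| <= `|a| + S.
  apply: le_trans (ler_normB _ _) _; rewrite lerD2l.
  exact: le_trans (ler_norm_sum _ _ _) _.
have wS : `|w| <= `|w - r| + `|r|.
  by rewrite {1}(_ : w = w - r + r) ?ler_normD// subrK.
have -> : d * (w / d * (1 + e)) - r = (w - r) + w * e by field.
have we : `|w * e| <= eps * `|w| by rewrite normrM mulrC ler_wpM2r.
apply: le_trans (ler_normD _ _) _; apply: le_trans (lerD (lexx _) we) _.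
have K1 : 1 <= 2 ^+ n.+3 :> R by rewrite exprn_ege1// ler1n.
rewrite [2 ^+ n.+1.+4]exprS [2 ^+ n.+4]exprS.
move: (2 ^+ n.+3) K1 wa => K K1 wa.
have : eps * `|w - r| <= `|w - r| by rewrite -[leRHS]mul1r ler_wpM2r.
have := ler_wpM2l eps_ge0 wS; have := ler_wpM2l eps_ge0 rS.
have aS : 0 <= eps * (`|a| + S) by rewrite mulr_ge0 ?addr_ge0.
have : eps * (`|a| + S) <= K * (eps * (`|a| + S)) by rewrite -[leLHS]mul1r ler_wpM2r.
lra.
Qed.

Let bound_ge0 k r (x : R) : 0 <= x -> 0 <= 2 ^+ k * r%:R * eps * x.
Proof.
move=> x0; have k0 : 0 <= 2 ^+ k :> R by rewrite exprn_ge0.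
by rewrite !mulr_ge0.
Qed.

Let bound_le k r (a b : R) : a <= r%:R * b ->
  2 ^+ k * eps * a <= 2 ^+ k * r%:R * eps * b.
Proof.
have : 0 <= 2 ^+ k :> R by rewrite exprn_ge0.
move: (2 ^+ k) => K K0 ab.
by rewrite -!mulrA ler_wpM2l// mulrCA ler_wpM2l.
Qed.

Lemma sum_norm_mul_le m r n (A : 'M[R]_(m, r)) (B : 'M[R]_(r, n)) D i j :
  \sum_(l | D l) `|A i l * B l j| <= r%:R * (`|A| * `|B|).
Proof.
apply: (@le_trans _ _ (\sum_l `|A i l * B l j|)).
  by rewrite [leRHS](bigID D)/= lerDl sumr_ge0.
rewrite mulr_natl (_ : _ *+ r = \sum_(l < r) (`|A| * `|B|)); last first.
  by rewrite sumr_const card_ord.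
by apply: ler_sum => l _; rewrite normrM ler_pM ?mx_norm_coef.
Qed.

Lemma fl_mulmx_error m r n (A : 'M[R]_(m, r)) (B : 'M[R]_(r, n)) C :
  fl_mulmx eps A B C ->
  `|C - A *m B| <= 2 ^+ r.+3 * r%:R * eps * (`|A| * `|B|).
Proof.
move=> ABC; apply: mx_norm_le => [|i j]; first by rewrite bound_ge0 ?mulr_ge0.
(* A leading zero summand can be added exactly, so a computed inner product is also a computed
   residual with a = 0 and the signs of A reversed. *)
have /fl_residual_error : fl_residual eps predT 0 (fun l => - A i l) (B^~ j) (C i j).
  have [t [tAB tC]] := ABC i j; exists (fun l => - t l); split=> [l _|].
    have [d [d1 ->]] := tAB l; exists d; split=> //; ring.
  have z0 : fl_sum eps [:: 0] (0 : R) by apply: fl_sum1.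
  rewrite (eq_map (g := t)) => [|l]; last by rewrite opprK.
  apply: fl_sumD z0 tC _; first exact: perm_refl.
  by exists 0; rewrite normr0; split=> //; ring.
rewrite normr0 !add0r -sumrN !mxE.
under [X in C i j - X]eq_bigr do rewrite mulNr opprK.
move=> /le_trans; apply.
apply: bound_le.
under eq_bigr do rewrite mulNr normrN.
exact: sum_norm_mul_le.
Qed.

Lemma fl_submulmx_error m r n (C : 'M[R]_(m, n)) (A : 'M[R]_(m, r))
    (B : 'M[R]_(r, n)) W :
  fl_submulmx eps C A B W ->
  `|W - (C - A *m B)| <= 2 ^+ r.+3 * r.+1%:R * eps * (`|C| + `|A| * `|B|).
Proof.
move=> CAB; apply: mx_norm_le => [|i j].
  by rewrite bound_ge0// addr_ge0// mulr_ge0.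
have := fl_residual_error (CAB i j); rewrite !mxE => /le_trans; apply.
apply: bound_le.
apply: le_trans (lerD (mx_norm_coef _ _ _) (sum_norm_mul_le _ _ _ _ _)) _.
have := mulr_ge0 (ler0n R r) (normr_ge0 C).
have := mulr_ge0 (normr_ge0 A) (normr_ge0 B); rewrite -natr1; lra.
Qed.

(** The residual of substitution, unlike the error of T, is free of the condition number of Y. *)
Lemma fl_trsm_error m n (W : 'M[R]_(m, n)) (Y : 'M[R]_n) T :
  (forall i j : 'I_n, (j < i)%N -> Y i j = 0) -> (forall j, Y j j != 0) ->
  fl_trsm eps W Y T ->
  `|W - T *m Y| <= 2 ^+ n.+1.+4 * n.+1%:R * eps * (`|W| + `|T| * `|Y|).
Proof.
move=> Yup Yd WYT; apply: mx_norm_le => [|i j].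
  by rewrite bound_ge0// addr_ge0// mulr_ge0.
have [w wr wd] := WYT i j.
have := fl_residual_div_error (Yd j) wr wd.
set S := \sum_(l | _) _.
have -> : Y j j * T i j - (W i j - S) = - (W - T *m Y) i j.
  rewrite !mxE (bigID (fun l : 'I_n => (l < j)%N))/= -/S.
  rewrite (bigD1 j) ?ltnn//= big1 => [|l]; first by ring.
  rewrite -leqNgt => /andP[jl lj]; rewrite Yup ?mulr0//.
  by rewrite ltn_neqAle jl eq_sym -val_eqE in lj *; rewrite lj.
rewrite normrN => /le_trans; apply.
apply: bound_le.
apply: le_trans (lerD (mx_norm_coef _ _ _) (sum_norm_mul_le _ _ _ _ _)) _.
have := mulr_ge0 (ler0n R n) (normr_ge0 W).
have := mulr_ge0 (normr_ge0 T) (normr_ge0 Y); rewrite -natr1; lra.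
Qed.

Lemma fl_addmx_error m n (A B C : 'M[R]_(m, n)) : fl_addmx eps A B C ->
  `|C - (A + B)| <= eps * (`|A| + `|B|).
Proof.
move=> ABC; apply: mx_norm_le => [|i j]; first by rewrite mulr_ge0 ?addr_ge0.
rewrite !mxE; apply: le_trans (fl_round_error (ABC i j)) _.
rewrite ler_wpM2l// (le_trans (ler_normD _ _))//.
by rewrite lerD ?mx_norm_coef.
Qed.

End RoundingErrors.

(** * Asymptotic domination along a filter *)

(** The index t will be a whole run of the algorithm, so C is uniform in eps and in the data. The
    norm on V lets scalars and matrices share one definition. *)
Definition dominated {R : realType} {T : Type} (F : set_system T)
    {V : normedZmodType R} (f : T -> V) (g : T -> R) :=
  exists2 C, 0 <= C & \forall t \near F, `|f t| <= C * g t.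

Section Domination.
Context {R : realType} {T : Type} (F : set_system T) {FF : Filter F}.
Local Notation "f <~ g" := (dominated F f g) (at level 70).

Lemma dominated_near (V V' : normedZmodType R) (f : T -> V) (f' : T -> V') g :
  (\forall t \near F, `|f t| <= `|f' t|) -> f' <~ g -> f <~ g.
Proof.
move=> ff' [C C0 f'g]; exists C => //.
by apply: filterS2 ff' f'g => t; exact: le_trans.
Qed.

Lemma dominated_eq (V : normedZmodType R) (f f' : T -> V) g :
  (forall t, f t = f' t) -> f' <~ g -> f <~ g.
Proof. by move=> ff'; apply: dominated_near; apply: nearW => t; rewrite ff'. Qed.

Lemma dominated_trans (V : normedZmodType R) (f : T -> V) (g h : T -> R) :
  f <~ g -> g <~ h -> f <~ h.
Proof.
move=> [C C0 fg] [D D0 gh]; exists (C * D); first exact: mulr_ge0.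
apply: filterS2 fg gh => t fg gh; rewrite (le_trans fg)// -mulrA ler_wpM2l//.
exact: le_trans (ler_norm _) gh.
Qed.

Lemma dominated_le (g h : T -> R) : (\forall t \near F, 0 <= g t <= h t) -> g <~ h.
Proof.
move=> gh; exists 1 => //.
by apply: filterS gh => t /andP[g0 gh]; rewrite mul1r ger0_norm.
Qed.

Lemma dominatedN (V : normedZmodType R) (f : T -> V) g :
  f <~ g -> (fun t => - f t) <~ g.
Proof. by apply: dominated_near; apply: nearW => t; rewrite normrN. Qed.

Lemma dominatedD (V : normedZmodType R) (f1 f2 : T -> V) g :
  f1 <~ g -> f2 <~ g -> (fun t => f1 t + f2 t) <~ g.
Proof.
move=> [C C0 f1g] [D D0 f2g]; exists (C + D); first exact: addr_ge0.
apply: filterS2 f1g f2g => t f1g f2g.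
by rewrite (le_trans (ler_normD _ _))// mulrDl lerD.
Qed.

Lemma dominatedB (V : normedZmodType R) (f1 f2 : T -> V) g :
  f1 <~ g -> f2 <~ g -> (fun t => f1 t - f2 t) <~ g.
Proof. by move=> f1g f2g; apply: dominatedD => //; exact: dominatedN. Qed.

Lemma dominated0 (V : normedZmodType R) g : (fun=> 0 : V) <~ g.
Proof. by exists 0 => //; apply: nearW => t; rewrite normr0 mul0r. Qed.

Lemma dominated_sum (V : normedZmodType R) I (r : seq I) (P : pred I)
    (f : I -> T -> V) g :
  (forall i, P i -> f i <~ g) -> (fun t => \sum_(i <- r | P i) f i t) <~ g.
Proof.
move=> fg; elim: r => [|i r IH].
  by apply: dominated_eq (dominated0 _ _) => t; rewrite big_nil.
have [Pi|/negbTE Pi] := boolP (P i).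
  apply: dominated_eq (dominatedD (fg i Pi) IH) => t.
  by rewrite big_cons Pi.
by apply: dominated_eq IH => t; rewrite big_cons Pi.
Qed.

Lemma dominatedM (f1 f2 : T -> R) g1 g2 :
  f1 <~ g1 -> f2 <~ g2 -> (fun t => f1 t * f2 t) <~ (fun t => g1 t * g2 t).
Proof.
move=> [C C0 f1g] [D D0 f2g]; exists (C * D); first exact: mulr_ge0.
apply: filterS2 f1g f2g => t f1g f2g.
by rewrite mulrACA normrM ler_pM.
Qed.

Lemma dominated_norm (V : normedZmodType R) (f : T -> V) g :
  f <~ g -> (fun t => `|f t|) <~ g.
Proof. by apply: dominated_near; apply: nearW => t; rewrite normr_id. Qed.

Lemma dominatedZ c (f : T -> R) g : f <~ g -> (fun t => c * f t) <~ g.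
Proof.
move=> [C C0 fg]; exists (`|c| * C); first exact: mulr_ge0.
by apply: filterS fg => t fg; rewrite normrM -mulrA ler_wpM2l.
Qed.

Lemma dominated_refl (g : T -> R) : (\forall t \near F, 0 <= g t) -> g <~ g.
Proof. by move=> g0; apply: dominated_le; apply: filterS g0 => t ->/=. Qed.

Lemma dominated_cst (V : normedZmodType R) (v : V) : (fun=> v) <~ (fun=> 1).
Proof. by exists `|v| => //; apply: nearW => t; rewrite mulr1. Qed.

(** For a computed quantity whose error bound contains its own norm, as in a triangular solve. *)
Lemma dominated_absorb (V : normedZmodType R) (f : T -> V) (h d : T -> R) g :
  (\forall t \near F, `|f t| <= h t + d t * `|f t|) ->
  (\forall t \near F, d t <= 1 / 2) -> h <~ g -> f <~ g.
Proof.
move=> fh d2 [C C0 hg]; exists (2 * C); first exact: mulr_ge0.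
apply: filterS3 fh d2 hg => t fh d2 hg.
have := ler_wpM2r (normr_ge0 (f t)) d2; have := ler_norm (h t); lra.
Qed.

Section Matrices.
Variables m n r : nat.
Implicit Types (A : T -> 'M[R]_(m, n)) (B : T -> 'M[R]_(n, r)).

Lemma dominated_mulmx A B g h :
  A <~ g -> B <~ h -> (fun t => A t *m B t) <~ (fun t => g t * h t).
Proof.
move=> [C C0 Ag] [D D0 Bh]; exists (n%:R * (C * D)); first by rewrite !mulr_ge0.
apply: filterS2 Ag Bh => t Ag Bh; apply: le_trans (mx_norm_mul _ _) _.
by rewrite -!mulrA ler_wpM2l// [leRHS]mulrA (mulrACA C D) ler_pM// mulrCA.
Qed.

Lemma dominated_trmx A g : A <~ g -> (fun t => (A t)^T) <~ g.
Proof. by apply: dominated_near; apply: nearW => t; rewrite mx_norm_tr. Qed.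

Lemma dominated_coef A g i j : A <~ g -> (fun t => A t i j) <~ g.
Proof. by apply: dominated_near; apply: nearW => t; exact: mx_norm_coef. Qed.

Lemma dominated_mx A g : (\forall t \near F, 0 <= g t) ->
  (forall i j, (fun t => A t i j) <~ g) -> A <~ g.
Proof.
move=> g0 Ag.
have [C C0 CA] : exists2 C, 0 <= C &
    forall i j, \forall t \near F, `|A t i j| <= C * g t.
  have /choice[C CP] ij : exists C, 0 <= C /\ \forall t \near F, `|A t ij.1 ij.2| <= C * g t.
    by have [C] := Ag ij.1 ij.2; exists C.
  exists (\sum_ij C ij); first by apply: sumr_ge0 => ij _; case: (CP ij).
  move=> i j; have [_] := CP (i, j); apply: filterS2 g0 => t g0 /le_trans; apply.
  rewrite ler_wpM2r// (bigD1 (i, j))//= lerDl sumr_ge0// => ij _.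
  by case: (CP ij).
exists C => //.
have H : \forall t \near F, forall ij : 'I_m * 'I_n, `|A t ij.1 ij.2| <= C * g t.
  by apply: filter_forall => -[i j]; exact: CA.
apply: filterS2 g0 H => t g0 At.
by apply: mx_norm_le => [|i j]; [exact: mulr_ge0|exact: (At (i, j))].
Qed.

End Matrices.
End Domination.

(** * Cholesky factorization *)

Section Coercive.
Context {R : realType}.

Lemma unitmx_of_ker0 n (W : 'M[R]_n) :
  (forall x : 'cV_n, W *m x = 0 -> x = 0) -> W \in unitmx.
Proof.
move=> W0; rewrite -unitmx_tr -row_free_unit -kermx_eq0; apply/negPn/negP.
move=> /rowV0Pn[v /sub_kermxP vW]; rewrite -trmx_eq0 => /eqP; apply.
by apply: W0; rewrite -[W]trmxK -trmx_mul vW trmx0.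
Qed.

(** The lower bound, applied to a column of the inverse, compares that column with a unit vector. *)
Lemma coercive_unitmx n (W : 'M[R]_n) (a : R) : 0 < a ->
  (forall x : 'cV_n, a * `|x| <= `|W *m x|) ->
  W \in unitmx /\ `|invmx W| <= a^-1.
Proof.
move=> a0 aW; have Wu : W \in unitmx.
  apply: unitmx_of_ker0 => x Wx; have := aW x.
  by rewrite Wx normr0 pmulr_rle0// normr_le0 => /eqP.
split=> //; apply: mx_norm_le => [|i j]; first by rewrite invr_ge0 ltW.
have := aW (invmx W *m delta_mx j 0); rewrite mulKVmx// -ler_pdivlMl// => Wj.
rewrite (_ : invmx W i j = (invmx W *m (delta_mx j 0 : 'cV_n)) i 0); last by rewrite -colE mxE.
apply: le_trans (mx_norm_coef _ _ _) _; apply: le_trans Wj _.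
rewrite ger_pMr ?invr_gt0//; apply: mx_norm_le => // k l; rewrite mxE.
by case: andP; rewrite ?normr1 ?normr0.
Qed.

(* The Schur complement of the leading k columns of H is the minimum of the
   quadratic form of H over vectors supported on these columns and j, with
   j-th entry 1.  The minimizer solves a triangular system with matrix Y. *)
Lemma schur_complement_ge n (H Y : 'M[R]_n) (k : nat) (j : 'I_n) (b eta : R) :
  (k <= j)%N -> H^T = H ->
  (forall i l : 'I_n, (l < i)%N -> Y i l = 0) ->
  (forall i : 'I_n, (i < k)%N -> Y i i != 0) ->
  0 <= b -> (forall x : 'cV_n, b * `|x| ^+ 2 <= (x^T *m H *m x) 0 0) ->
  0 <= eta -> n%:R ^+ 2 * eta <= b / 2 ->
  (forall i l : 'I_n, (i <= l)%N -> (i < k)%N -> (l < k)%N || (l == j) ->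
    `|(Y^T *m Y) i l - H i l| <= eta) ->
  b / 2 <= H j j - \sum_(i < n | (i < k)%N) Y i j ^+ 2.
Proof.
move=> kj Hsym Yup Yd b0 Hb eta0 etab YH.
(* Padding the leading block by the identity keeps it triangular and makes it invertible, although
   nothing is known of the later pivots. *)
pose Yk : 'M[R]_n := \matrix_(i, l) if (i < k)%N && (l < k)%N then Y i l else (i == l)%:R.
have Yku : Yk \in unitmx.
  rewrite -unitmx_tr unitmxE det_trig.
    rewrite unitfE; apply/prodf_neq0 => i _; rewrite !mxE andbb eqxx.
    by case: ifPn => [/Yd//|_]; rewrite oner_neq0.
  apply/is_trig_mxP => i l il; rewrite !mxE; case: ifP => _; first exact: Yup.
  by rewrite -val_eqE/= gtn_eqF.
pose v : 'cV[R]_n := \col_i if (i < k)%N then Y i j else 0.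
have [z Ykz] : exists z, Yk *m z = v by exists (invmx Yk *m v); rewrite mulKVmx.
have z0 (i : 'I_n) : (k <= i)%N -> z i 0 = 0.
  move=> ki; have /matrixP/(_ i 0) := Ykz; rewrite [v i 0]mxE ltnNge ki/= => Yz.
  rewrite -[RHS]Yz mxE (bigD1 i)//= big1 => [|l li].
    by rewrite [Yk i i]mxE ltnNge ki/= eqxx mul1r addr0.
  by rewrite [Yk i l]mxE ltnNge ki/= eq_sym (negbTE li) mul0r.
(* As z solves the leading triangular system for column j, the first k rows of Y annihilate x. *)
pose x : 'cV_n := delta_mx j 0 - z.
have xj : x j 0 = 1 by rewrite !mxE z0// !eqxx subr0.
have x0 (i : 'I_n) : (k <= i)%N -> i != j -> x i 0 = 0.
  by move=> ki ij; rewrite !mxE z0// (negbTE ij) subr0.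
pose Ym : 'M[R]_n := \matrix_(i, l) if (i < k)%N then Y i l else 0.
have Ymx : Ym *m x = 0.
  apply/matrixP => i l; rewrite ord1 mulmxBr -colE !mxE.
  case: ifPn => [ik|ik]; last first.
    by rewrite big1 ?subr0// => a _; rewrite mxE (negbTE ik) mul0r.
  have /matrixP/(_ i 0) := Ykz; rewrite [v i 0]mxE ik => <-.
  rewrite mxE -sumrB big1// => a _; rewrite !mxE ik/=.
  by case: ltnP => [|ka]; rewrite ?subrr// z0// !mulr0 subrr.
clearbody x.
pose D := H - Ym^T *m Ym.
have xDx : x^T *m D *m x = x^T *m H *m x.
  by rewrite mulmxBr mulmxBl !mulmxA -[_ *m Ym *m x]mulmxA Ymx mulmx0 subr0.
pose S (i : 'I_n) := (i < k)%N || (i == j).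
have xS i : ~~ S i -> x i 0 = 0.
  by rewrite negb_or -leqNgt => /andP[]; exact: x0.
(* On the support of x, every entry of D is an error bounded by eta, except the entry (j, j), which
   is the Schur complement. *)
pose D' := \matrix_(a, c) if S a && S c && ((a != j) || (c != j)) then D a c else 0.
have YmE (a c : 'I_n) : (a < k)%N -> (Ym^T *m Ym) a c = (Y^T *m Y) a c.
  move=> ak; rewrite !mxE; apply: eq_bigr => i _; rewrite !mxE.
  by case: ltnP => // ki; rewrite (Yup i a) ?mul0r// (leq_trans ak).
have Dsym a c : D a c = D c a.
  have Dt : D^T = D by rewrite linearB/= Hsym trmx_mul trmxK.
  by rewrite -[in LHS]Dt mxE.
have D'eta : `|D'| <= eta.
  apply: mx_norm_le => // a c; rewrite mxE; case: ifPn => [|_]; last by rewrite normr0.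
  wlog ac : a c / (a <= c)%N => [wl|].
    case/orP: (leq_total a c) => ac; first exact: wl.
    by rewrite Dsym => ?; apply: wl => //; rewrite [S c && _]andbC orbC.
  move=> /andP[/andP[Sa Sc] acj].
  have ak : (a < k)%N.
    case/orP: Sa => // /eqP aj; move: acj; rewrite aj eqxx/= => cj.
    case/orP: Sc => [ck|]; last by rewrite (negbTE cj).
    by rewrite -aj; exact: leq_ltn_trans ck.
  rewrite (_ : D a c = H a c - (Ym^T *m Ym) a c); last by rewrite !mxE.
  by rewrite YmE// distrC YH.
have Djj : D j j = H j j - \sum_(i < n | (i < k)%N) Y i j ^+ 2.
  rewrite !mxE; congr (_ - _); rewrite [RHS]big_mkcond/=; apply: eq_bigr => i _.
  by rewrite !mxE; case: ifP; rewrite ?mulr0// expr2.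
have xDE : (x^T *m D *m x) 0 0 = (x^T *m D' *m x) 0 0 + D j j.
  have E (A : 'M[R]_n) : (x^T *m A *m x) 0 0 =
      \sum_(ac : 'I_n * 'I_n) x ac.1 0 * A ac.1 ac.2 * x ac.2 0.
    rewrite -(pair_bigA _ (fun a c => x a 0 * A a c * x c 0))/=.
    rewrite -mulmxA mxE; apply: eq_bigr => a _; rewrite !mxE mulr_sumr.
    by apply: eq_bigr => c _; rewrite mulrA.
  rewrite !E (bigD1 (j, j))//= [in RHS](bigD1 (j, j))//= xj.
  rewrite [D' j j]mxE eqxx/= andbF mulr0 mul0r add0r mul1r mulr1 addrC.
  congr (_ + _); apply: eq_bigr => -[a c] /= acj; rewrite [D' a c]mxE.
  have -> : (a != j) || (c != j) by rewrite -negb_and -xpair_eqE.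
  rewrite andbT.
  by case: (boolP (S a)) => [Sa|/xS->]; case: (boolP (S c)) => [Sc|/xS->];
    rewrite /= ?(mul0r, mulr0).
(* The error term grows with |x|^2 and is charged to half of b |x|^2; the other half is at least b /
   2 because x has entry 1 at j. *)
have x1 : 1 <= `|x| ^+ 2.
  by rewrite exprn_ege1//; have := mx_norm_coef x j 0; rewrite xj normr1.
have := Hb x; rewrite -xDx xDE Djj.
have := mx_norm_quad D' x; rewrite ler_norml => /andP[_].
have : n%:R ^+ 2 * `|D'| * `|x| ^+ 2 <= b / 2 * `|x| ^+ 2.
  by rewrite ler_wpM2r ?sqr_ge0// (le_trans _ etab)// ler_wpM2l ?sqr_ge0.
have : b <= b * `|x| ^+ 2 by rewrite -[leLHS]mulr1 ler_wpM2l.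
lra.
Qed.

End Coercive.

(** The strict inequality makes the exact pivot exceed its rounding error; hence w > 0 and the
    square root does not break down. Squaring the root adds the relative error d (2 + d), of modulus
    at most 3 eps. *)
Lemma fl_residual_sqrt_error {R : realType} (eps : R) n (D : pred 'I_n) a
    (x y : 'I_n -> R) w z :
  0 <= eps -> eps <= 1 / 2 ->
  2 ^+ n.+3 * eps * (`|a| + \sum_(l | D l) `|x l * y l|) <
    a - \sum_(l | D l) x l * y l ->
  fl_residual eps D a x y w -> fl_sqrt eps w z ->
  0 < z /\ `|z * z - (a - \sum_(l | D l) x l * y l)| <=
    2 ^+ n.+1.+4 * 2 ^+ 2 * eps * (`|a| + \sum_(l | D l) `|x l * y l|).
Proof.
move=> e0 e2 + wr wz; have e1 : eps <= 1 by lra.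
have := fl_residual_error e0 e1 wr.
set S := \sum_(l | D l) `|x l * y l|.
have S0 : 0 <= S by apply: sumr_ge0.
set r := a - _; have rS : `|r| <= `|a| + S.
  apply: le_trans (ler_normB _ _) _; rewrite lerD2l.
  exact: le_trans (ler_norm_sum _ _ _) _.
have K1 : 1 <= 2 ^+ n.+3 :> R by rewrite exprn_ege1// ler1n.
rewrite [2 ^+ n.+1.+4]exprS [2 ^+ n.+4]exprS [2 ^+ 2]expr2.
move: (2 ^+ n.+3) K1 => K K1; rewrite ler_norml => /andP[wl wu] rl.
have w0 : 0 < w by lra.
have aS0 : 0 <= eps * (`|a| + S) by rewrite mulr_ge0 ?addr_ge0.
have KaS0 : eps * (`|a| + S) <= K * (eps * (`|a| + S)).
  by rewrite -[leLHS]mul1r ler_wpM2r.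
have [d [de ->]] := wz (ltW w0).
have d1 : `|d| <= 1 / 2 by exact: le_trans e2.
move: (d1); rewrite ler_norml => /andP[dl du].
split; first by rewrite mulr_gt0 ?sqrtr_gt0//; lra.
rewrite (_ : _ * _ - r = (w - r) + w * (d * (2 + d))); last first.
  have := sqr_sqrtr (ltW w0); set q := Num.sqrt w => <-; ring.
have wd : `|w * (d * (2 + d))| <= w * (eps * 3).
  rewrite !normrM (gtr0_norm w0) ler_pM2l// ler_pM//.
  by rewrite ler_norml; lra.
have wS : w <= `|a| + S + K * (eps * (`|a| + S)) by have := ler_norm r; lra.
have : eps * w <= eps * (`|a| + S) + eps * (K * (eps * (`|a| + S))).
  by rewrite -mulrDr ler_wpM2l.
have : eps * (K * (eps * (`|a| + S))) <= 1 / 2 * (K * (eps * (`|a| + S))).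
  by rewrite ler_wpM2r//; lra.
move=> h1 h2; apply: le_trans (ler_normD _ _) _; apply: le_trans (lerD (lexx _) wd) _.
have : `|w - r| <= K * (eps * (`|a| + S)) by rewrite ler_norml; lra.
lra.
Qed.

Lemma trmx_add (R : realType) m n (A B : 'M[R]_(m, n)) : (A + B)^T = A^T + B^T.
Proof. exact: linearD. Qed.

Lemma trmx_sub (R : realType) m n (A B : 'M[R]_(m, n)) : (A - B)^T = A^T - B^T.
Proof. exact: linearB. Qed.

(* The matrix products are the atoms of the final call to ring. *)
Ltac mx_lin :=
  repeat (rewrite trmxK || rewrite trmx_mul || rewrite trmx_sub || rewrite trmx_add
    || rewrite trmx1);
  rewrite /= ?(mulmxBl, mulmxBr, mulmxDl, mulmxDr, mulNmx, mulmxN, mul1mx, mulmx1, mulmxA);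
  repeat match goal with
  | |- context [@mulmx ?R ?m ?n ?p ?A ?B] =>
      let x := fresh "x" in set x := (@mulmx R m n p A B); move: x => x
  end;
  apply/matrixP => ? ?; rewrite ?mxE; ring.

(** * The perturbation regime: eps kappa^3 tends to 0 *)

Section Regime.
Context {R : realType} {T : Type} (F : set_system T) {FF : Filter F}.
Variables eps M sg : T -> R.
Local Notation "f <~ g" := (dominated F f g) (at level 70).

(** Smallness of eps kappa^3 is written without division. Since sg <= M, lower powers of kappa
    become small as well. *)
Definition regime :=
  (\forall t \near F, [/\ 0 < eps t, 0 < sg t & sg t <= M t]) /\
  (forall c, 0 < c -> \forall t \near F, eps t * M t ^+ 3 <= c * sg t ^+ 3).

Hypothesis reg : regime.

Lemma regime_small2 c : 0 < c ->
  \forall t \near F, eps t * M t ^+ 2 <= c * sg t ^+ 2.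
Proof.
move=> c0; have [pos small] := reg.
apply: filterS2 pos (small c c0) => t [e0 s0 sM] small3.
have M0 : 0 < M t by exact: lt_le_trans sM.
rewrite -(ler_pM2r M0) -mulrA -exprSr (le_trans small3)//.
by rewrite exprSr mulrA ler_wpM2l// mulr_ge0 ?sqr_ge0// ltW.
Qed.

Lemma regime_small1 c : 0 < c -> \forall t \near F, eps t * M t <= c * sg t.
Proof.
move=> c0; have [pos _] := reg.
apply: filterS2 pos (regime_small2 c0) => t [e0 s0 sM] small2.
have M0 : 0 < M t by exact: lt_le_trans sM.
rewrite -(ler_pM2r M0) -mulrA -expr2 (le_trans small2)//.
by rewrite expr2 mulrA ler_wpM2l// mulr_ge0// ltW.
Qed.

Lemma regime_small0 c : 0 < c -> \forall t \near F, eps t <= c.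
Proof.
move=> c0; have [pos _] := reg.
apply: filterS2 pos (regime_small1 c0) => t [e0 s0 sM] small1.
have M0 : 0 < M t by exact: lt_le_trans sM.
by rewrite -(ler_pM2r M0) (le_trans small1)// ler_wpM2l// ltW.
Qed.

Lemma regimeP : \forall t \near F,
  [/\ 0 < eps t, eps t <= 1, 0 < sg t & sg t <= M t].
Proof.
by apply: filterS2 reg.1 (regime_small0 ltr01) => t [].
Qed.

Lemma eM2_ge0 : \forall t \near F, 0 <= eps t * M t ^+ 2.
Proof. by apply: filterS regimeP => t [e0 *]; rewrite mulr_ge0 ?sqr_ge0// ltW. Qed.

Lemma M_ge0 : \forall t \near F, 0 <= M t.
Proof. by apply: filterS regimeP => t [_ _ s0 /(le_trans _)]; apply; exact: ltW. Qed.

Lemma dominated_sqr (f : T -> R) :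
  (fun t => f t ^+ 2) <~ (fun t => M t ^+ 2) -> f <~ M.
Proof.
(* C + 1 stands in for the square root of C. *)
move=> [C C0 fM]; exists (C + 1); first exact: addr_ge0.
apply: filterS2 M_ge0 fM => t M0 fM.
rewrite -(@ler_pXn2r _ 2)// ?nnegrE ?mulr_ge0 ?addr_ge0//.
rewrite -normrX (le_trans fM)// exprMn ler_wpM2r ?sqr_ge0//.
by rewrite expr2; have := mulr_ge0 C0 C0; lra.
Qed.

Lemma dominated_residual n (D : pred 'I_n) (K : R) (a f : T -> R)
    (x y : 'I_n -> T -> R) : 0 <= K ->
  (\forall t \near F, `|f t - (a t - \sum_(l | D l) x l t * y l t)| <=
     K * eps t * (`|a t| + \sum_(l | D l) `|x l t * y l t|)) ->
  a <~ (fun t => M t ^+ 2) -> (forall l, D l -> x l <~ M) ->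
  (forall l, D l -> y l <~ M) ->
  (fun t => f t - (a t - \sum_(l | D l) x l t * y l t)) <~
    (fun t => eps t * M t ^+ 2).
Proof.
move=> K0 fK aM xM yM.
apply: (@dominated_near _ _ _ _ _ _ _
  (fun t => K * (eps t * (`|a t| + \sum_(l | D l) `|x l t * y l t|)))).
  by apply: filterS fK => t; rewrite mulrA => /le_trans; apply; exact: ler_norm.
apply/dominatedZ/dominatedM; first by apply: dominated_refl;
  apply: filterS regimeP => t [/ltW].
apply: dominatedD; first exact: dominated_norm.
by apply: dominated_sum => l Dl; apply: dominated_norm; exact: dominatedM (xM _ Dl) (yM _ Dl).
Qed.

Lemma dominated_small (V : normedZmodType R) (f : T -> V) c : 0 < c ->
  f <~ (fun t => eps t * M t ^+ 2) ->
  \forall t \near F, `|f t| <= c * sg t ^+ 2.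
Proof.
move=> c0 [C C0 fC]; have K0 : 0 < C + 1 by rewrite ltr_wpDl.
apply: filterS3 eM2_ge0 fC (regime_small2 (divr_gt0 c0 K0)) => t e0 fC.
rewrite mulrAC ler_pdivlMr//; lra.
Qed.

Lemma eM2_le_M2 : (fun t => eps t * M t ^+ 2) <~ (fun t => M t ^+ 2).
Proof.
apply: dominated_le; apply: filterS2 eM2_ge0 regimeP => t -> [_ e1 _ _] /=.
by rewrite -[leRHS]mul1r ler_wpM2r ?sqr_ge0.
Qed.

(** * Stability of the computed Cholesky factor *)

Section Cholesky.
Variables (n : nat) (G H Y : T -> 'M[R]_n) (c : R).
Hypotheses (c_gt0 : 0 < c) (cholY : \forall t \near F, fl_chol (eps t) (G t) (Y t)).
Hypotheses (Hsym : \forall t \near F, (H t)^T = H t)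
  (Hpos : \forall t \near F, forall x : 'cV_n,
    c * sg t ^+ 2 * `|x| ^+ 2 <= (x^T *m H t *m x) 0 0).
Hypotheses (GH : (fun t => G t - H t) <~ (fun t => eps t * M t ^+ 2))
  (HM : H <~ (fun t => M t ^+ 2)).

Let y i j t := Y t i j.
Let E i j t := ((Y t)^T *m Y t) i j - H t i j.

Let schur (k : nat) (j : 'I_n) : (k <= j)%N ->
  (forall i : 'I_n, (i < k)%N -> \forall t \near F, 0 < Y t i i) ->
  (forall i l : 'I_n, (i <= l)%N -> (i < k)%N -> (l < k)%N || (l == j) ->
    E i l <~ (fun t => eps t * M t ^+ 2)) ->
  \forall t \near F,
    c * sg t ^+ 2 / 2 <= H t j j - \sum_(i < n | (i < k)%N) Y t i j ^+ 2.
Proof.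
move=> kj Yd YE.
pose S (i l : 'I_n) := [&& (i <= l)%N, (i < k)%N & (l < k)%N || (l == j)].
(* Collecting the errors of the entries treated so far in one matrix yields the single constant C
   that serves as eta. *)
pose D t := \matrix_(i, l) if S i l then E i l t else 0.
have [C C0 CD] : D <~ (fun t => eps t * M t ^+ 2).
  apply: dominated_mx; first exact: (eM2_ge0).
  move=> i l; have [/and3P[il ik lkj]|Sil] := boolP (S i l).
    by apply: dominated_eq (YE _ _ il ik lkj) => t; rewrite mxE /S il ik lkj.
  by apply: dominated_eq (dominated0 _ _) => t; rewrite mxE (negbTE Sil).
have Ydk : \forall t \near F, forall i : 'I_n, (i < k)%N -> Y t i i != 0.
  apply: filter_forall => i; case: (ltnP i k) => [ik|ki].
    by apply: filterS (Yd i ik) => t Yii _; rewrite gt_eqF.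
  by apply: nearW.
have small : \forall t \near F, n%:R ^+ 2 * (C * (eps t * M t ^+ 2)) <= c * sg t ^+ 2 / 2.
  have K0 : 0 < n%:R ^+ 2 * C + 1 by rewrite ltr_wpDl// mulr_ge0 ?sqr_ge0.
  have sm := regime_small2 (divr_gt0 (divr_gt0 c_gt0 (ltr0Sn _ 1)) K0).
  apply: filterS2 (eM2_ge0) sm => t e0.
  rewrite mulrAC ler_pdivlMr//; lra.
near=> t.
have [Yup _ _] : fl_chol (eps t) (G t) (Y t) by near: t.
have e0 : 0 <= eps t * M t ^+ 2 by near: t; exact: (eM2_ge0).
apply: (@schur_complement_ge _ _ _ _ _ _ _ (C * (eps t * M t ^+ 2))) => //.
- by near: t.
- by near: t.
- by rewrite mulr_ge0 ?sqr_ge0// ltW.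
- by near: t.
- exact: mulr_ge0.
- by near: t.
- move=> i l il ik lkj.
  have Dt : `|D t| <= C * (eps t * M t ^+ 2) by near: t.
  apply: le_trans Dt; apply: le_trans (mx_norm_coef _ i l).
  by rewrite [D t i l]mxE /S il ik lkj.
Unshelve. all: by end_near. Qed.

Let GM : G <~ (fun t => M t ^+ 2).
Proof.
apply: dominated_eq (dominatedD (dominated_trans GH eM2_le_M2) HM) => t.
by rewrite subrK.
Qed.

Let gramE (Y0 : 'M[R]_n) (i j : 'I_n) :
  (forall i l : 'I_n, (l < i)%N -> Y0 i l = 0) ->
  (Y0^T *m Y0) i j = Y0 i i * Y0 i j + \sum_(l < n | (l < i)%N) Y0 l i * Y0 l j.
Proof.
move=> Yup; rewrite mxE (bigID (fun l : 'I_n => (l < i)%N))/= addrC; congr (_ + _).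
  rewrite (bigD1 i) ?ltnn//= big1 => [|l /andP[il li]]; first by rewrite addr0 !mxE.
  rewrite mxE Yup ?mul0r// ltn_neqAle leqNgt il andbT.
  by rewrite eq_sym; move: li; rewrite -val_eqE.
by apply: eq_bigr => l _; rewrite mxE.
Qed.

(** The constant is that of the square root step, so diagonal and off-diagonal entries are handled
    together. *)
Let entry_bound (i j : 'I_n) :
  (\forall t \near F, `|Y t i i * Y t i j
      - (G t i j - \sum_(l < n | (l < i)%N) Y t l i * Y t l j)| <=
    2 ^+ n.+1.+4 * 2 ^+ 2 * eps t *
      (`|G t i j| + \sum_(l < n | (l < i)%N) `|Y t l i * Y t l j|)) ->
  (forall l : 'I_n, (l < i)%N -> y l i <~ M /\ y l j <~ M) ->
  E i j <~ (fun t => eps t * M t ^+ 2).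
Proof.
move=> Yij YM; pose K : R := 2 ^+ n.+1.+4 * 2 ^+ 2.
have K0 : 0 <= K by apply: mulr_ge0; apply: exprn_ge0.
have GijM : (fun t => G t i j) <~ (fun t => M t ^+ 2) by exact: dominated_coef GM.
have GHij : (fun t => (G t - H t) i j) <~ (fun t => eps t * M t ^+ 2).
  exact: dominated_coef GH.
have res := dominated_residual K0 Yij GijM
  (fun l li => (YM l li).1) (fun l li => (YM l li).2).
apply: dominated_near (dominatedD res GHij).
apply: filterS cholY => t [Yup _ _].
rewrite /E gramE// !mxE; rewrite le_eqVlt; apply/orP; left; apply/eqP; congr (`|_|); ring.
Qed.

(** Entries of column j are treated from the top. The error of an entry is controlled once the
    entries above it are O(M), and conversely a nonnegative Schur complement bounds the sum of
    squares of the entries above the diagonal by H_jj. So there is no element growth. *)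
Let column (j : 'I_n) :
  (forall l : 'I_n, (l < j)%N -> \forall t \near F, 0 < Y t l l) ->
  (forall a l : 'I_n, (a <= l)%N -> (l < j)%N ->
    y a l <~ M /\ E a l <~ (fun t => eps t * M t ^+ 2)) ->
  (\forall t \near F, 0 < Y t j j) /\
  forall a : 'I_n, (a <= j)%N ->
    y a j <~ M /\ E a j <~ (fun t => eps t * M t ^+ 2).
Proof.
move=> Yd YE.
have row_bound k (a : 'I_n) : (k <= j)%N -> (a < k)%N ->
    (forall i l : 'I_n, (i <= l)%N -> (i < k)%N -> (l < k)%N || (l == j) ->
      E i l <~ (fun t => eps t * M t ^+ 2)) -> y a j <~ M.
  move=> kj ak YEk; apply: dominated_sqr.
  have HjM : (fun t => H t j j) <~ (fun t => M t ^+ 2) by exact: dominated_coef HM.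
  apply: dominated_near HjM.
  have Ydk (i : 'I_n) : (i < k)%N -> \forall t \near F, 0 < Y t i i.
    by move=> ik; apply: Yd; exact: leq_trans kj.
  apply: filterS2 regimeP (schur kj Ydk YEk) => t [_ _ s0 _].
  rewrite (bigD1 a)//= -/(y a j t) => sch.
  have sum0 : 0 <= \sum_(i < n | (i < k)%N && (i != a)) Y t i j ^+ 2.
    by apply: sumr_ge0 => i _; exact: sqr_ge0.
  have : 0 <= c * sg t ^+ 2 by rewrite mulr_ge0 ?sqr_ge0// ltW.
  by rewrite ger0_norm ?sqr_ge0//; have := ler_norm (H t j j); lra.
have offdiag k : (k <= j)%N -> forall a : 'I_n, (a < k)%N ->
    y a j <~ M /\ E a j <~ (fun t => eps t * M t ^+ 2).
  elim: k => // k IH kj a; rewrite ltnS leq_eqVlt => /predU1P[ak|]; last first.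
    by apply: IH; exact: ltnW.
  have aj : (a < j)%N by rewrite ak.
  have Eaj : E a j <~ (fun t => eps t * M t ^+ 2).
    apply: entry_bound => [|l la]; last first.
      split; first by apply: (YE _ _ _ aj).1; exact: ltnW.
      by apply: (IH (ltnW kj) l _).1; rewrite -ak.
    apply: filterS3 regimeP cholY (Yd a aj) => t [e0 e1 _ _] [_ off _] Yaa.
    have [w wr wd] := off a j aj.
    have Yaa0 : Y t a a != 0 by rewrite gt_eqF.
    have := fl_residual_div_error (ltW e0) e1 Yaa0 wr wd => /le_trans; apply.
    rewrite ler_wpM2r ?addr_ge0 ?sumr_ge0// ler_wpM2r ?(ltW e0)//.
    have := exprn_ge0 n.+1.+4 (ler0n R 2); move: (2 ^+ n.+1.+4) => K K0.
    by rewrite expr2; lra.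
  split=> //; apply: (row_bound k.+1) => //; first by rewrite ak.
  move=> i l il; rewrite ltnS leq_eqVlt => /predU1P[ik|ik] /orP[lk|/eqP->].
  - by apply: (YE _ _ il _).2; exact: leq_trans kj.
  - by rewrite (_ : i = a)//; apply/val_inj; rewrite /= ak.
  - by apply: (YE _ _ il _).2; exact: leq_trans kj.
  - exact: (IH (ltnW kj) i ik).2.
have schj := schur (leqnn j) Yd.
have {}schj : \forall t \near F,
    c * sg t ^+ 2 / 2 <= H t j j - \sum_(i < n | (i < j)%N) Y t i j ^+ 2.
  apply: schj => i l il ij /orP[lj|/eqP->]; first exact: (YE _ _ il lj).2.
  exact: (offdiag j _ i ij).2.
pose e0 (K : R) t := K * eps t *
  (`|G t j j| + \sum_(l < n | (l < j)%N) `|Y t l j * Y t l j|).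
have e0_small K : 0 <= K -> e0 K <~ (fun t => eps t * M t ^+ 2).
  move=> K0; apply: (@dominated_eq _ _ _ _ _ _ (fun t => K * (eps t *
      (`|G t j j| + \sum_(l < n | (l < j)%N) `|Y t l j * Y t l j|)))).
    by move=> t; rewrite mulrA.
  apply/dominatedZ/dominatedM.
    by apply: dominated_refl; apply: filterS regimeP => t [/ltW].
  apply: dominatedD; first by apply/dominated_norm/dominated_coef/GM.
  apply: dominated_sum => l lj; apply: dominated_norm.
  have ylj := (offdiag j (leqnn j) l lj).1.
  exact: (dominatedM ylj ylj).
have GHj : (fun t => (G t - H t) j j) <~ (fun t => eps t * M t ^+ 2).
  exact: dominated_coef GH.
have K0 : 0 <= 2 ^+ n.+3 :> R by exact: exprn_ge0.
(* The Schur complement is at least c sg^2 / 2. Replacing H by G and rounding each cost at most c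
   sg^2 / 8, so the pivot stays positive. *)
have c8 : 0 < c / 8 by rewrite divr_gt0.
have sm1 := dominated_small c8 GHj.
have sm2 := dominated_small c8 (e0_small _ K0).
have diag : \forall t \near F, 0 < Y t j j /\ `|Y t j j * Y t j j
      - (G t j j - \sum_(l < n | (l < j)%N) Y t l j * Y t l j)| <=
    2 ^+ n.+1.+4 * 2 ^+ 2 * eps t *
      (`|G t j j| + \sum_(l < n | (l < j)%N) `|Y t l j * Y t l j|).
  have half : \forall t \near F, eps t <= 1 / 2 by apply: regime_small0.
  near=> t.
  have [ep ep1 s0 sM] : [/\ 0 < eps t, eps t <= 1, 0 < sg t & sg t <= M t].
    by near: t; exact: regimeP.
  have [_ _ /(_ j)[w wr ws]] : fl_chol (eps t) (G t) (Y t) by near: t.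
  apply: fl_residual_sqrt_error wr ws; first exact: ltW.
    by near: t.
  have h1 : `|(G t - H t) j j| <= c / 8 * sg t ^+ 2 by near: t.
  have h2 : `|e0 (2 ^+ n.+3) t| <= c / 8 * sg t ^+ 2 by near: t.
  have h3 : c * sg t ^+ 2 / 2 <= H t j j - \sum_(i < n | (i < j)%N) Y t i j ^+ 2.
    by near: t.
  rewrite -/(e0 _ t).
  under eq_bigr do rewrite -expr2.
  move: h1; rewrite !mxE ler_norml => /andP[h1 _].
  have h4 : 0 < c * sg t ^+ 2 by rewrite mulr_gt0 ?exprn_gt0.
  have := ler_norm (e0 (2 ^+ n.+3) t); lra.
have Ejj : E j j <~ (fun t => eps t * M t ^+ 2).
  apply: entry_bound => [|l lj]; last by have := (offdiag j (leqnn j) l lj).1.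
  by apply: filterS diag => t [].
have yjj : y j j <~ M.
  apply: dominated_sqr.
  have HjM : (fun t => H t j j) <~ (fun t => M t ^+ 2) by exact: dominated_coef HM.
  apply: dominated_near (dominatedD (dominated_trans Ejj eM2_le_M2) HjM).
  apply: filterS cholY => t [Yup _ _].
  rewrite /E subrK gramE// -expr2; under eq_bigr do rewrite -expr2.
  have sum0 : 0 <= \sum_(l < n | (l < j)%N) Y t l j ^+ 2.
    by apply: sumr_ge0 => i _; exact: sqr_ge0.
  by rewrite !ger0_norm ?addr_ge0 ?sqr_ge0// lerDl.
split; first by apply: filterS diag => t [].
move=> a; rewrite leq_eqVlt => /predU1P[/val_inj->//|aj].
exact: (offdiag j (leqnn j) a aj).
Unshelve. all: by end_near. Qed.

Lemma fl_chol_stable :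
  [/\ \forall t \near F, forall j, 0 < Y t j j, Y <~ M &
    (fun t => (Y t)^T *m Y t - H t) <~ (fun t => eps t * M t ^+ 2)].
Proof.
have cols k (j : 'I_n) : (j < k)%N -> (\forall t \near F, 0 < Y t j j) /\
  forall a : 'I_n, (a <= j)%N -> y a j <~ M /\ E a j <~ (fun t => eps t * M t ^+ 2).
  elim: k j => // k IH j; rewrite ltnS => jk; apply: column => [l lj|a l al lj].
    exact: (IH l (leq_trans lj jk)).1.
  exact: (IH l (leq_trans lj jk)).2.
split.
- by apply: filter_forall => j; exact: (cols n j (ltn_ord j)).1.
- apply: dominated_mx; first exact: M_ge0.
  move=> i j; case: (leqP i j) => [ij|ji].
    exact: ((cols n j (ltn_ord j)).2 i ij).1.
  apply: dominated_near (@dominated0 _ _ _ _ R _).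
  by apply: filterS cholY => t [Yup _ _]; rewrite Yup.
- apply: dominated_mx; first exact: eM2_ge0.
  move=> i j; case: (leqP i j) => [ij|ji].
    apply: dominated_eq ((cols n j (ltn_ord j)).2 i ij).2 => t.
    by rewrite /E !mxE.
  (* Below the diagonal the bound follows from the symmetry of Y^T Y and H. *)
  apply: dominated_near ((cols n i (ltn_ord i)).2 j (ltnW ji)).2.
  apply: filterS Hsym => t Hs; rewrite /E -{1}Hs !mxE.
  rewrite le_eqVlt; apply/orP; left; apply/eqP; congr (`|_ - _|).
  by apply: eq_bigr => l _; rewrite !mxE mulrC.
Qed.

End Cholesky.

(** * Error scales *)

Local Notation eM := (fun t => eps t * M t).
Local Notation eM2 := (fun t => eps t * M t ^+ 2).
(** [k1] is eps kappa M, the accuracy of the first-pass coefficients; [k2] is eps kappa^2, the loss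
    of orthogonality. *)
Local Notation k1 := (fun t => eps t * M t ^+ 2 / sg t).
Local Notation k2 := (fun t => eps t * M t ^+ 2 / sg t ^+ 2).
Local Notation isg := (fun t => (sg t)^-1).

(* In terms of e = eps M^3 / sg^3 and r = sg / M, both in [0, 1], all error
   scales are monomials. *)
Lemma dominated_scale (q : R -> R -> R) (g h : T -> R) :
  (forall e r, 0 <= e -> e <= 1 -> 0 <= r -> r <= 1 -> 0 <= q e r <= 1) ->
  (\forall t \near F, 0 <= h t) ->
  (forall t, 0 < eps t -> 0 < sg t -> 0 < M t ->
    g t = h t * q (eps t * M t ^+ 3 / sg t ^+ 3) (sg t / M t)) ->
  g <~ h.
Proof.
move=> q01 h0 gE; apply: dominated_le.
apply: filterS3 h0 regimeP (reg.2 1 ltr01) => t h0 [e0 e1 s0 sM] e3.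
have M0 : 0 < M t by exact: lt_le_trans sM.
rewrite gE//; set q' := q _ _.
have /andP[q0 q1] : 0 <= q' <= 1.
  apply: q01.
  - by rewrite divr_ge0 ?mulr_ge0 ?exprn_ge0// ltW.
  - by rewrite ler_pdivrMr ?exprn_gt0.
  - by rewrite divr_ge0 ?ltW.
  - by rewrite ler_pdivrMr// mul1r.
by rewrite mulr_ge0//= -[leRHS]mulr1 ler_wpM2l.
Qed.

Lemma eM_ge0 : \forall t \near F, 0 <= eM t.
Proof. by apply: filterS2 M_ge0 regimeP => t M0 [e0 _ _ _]; rewrite mulr_ge0// ltW. Qed.

Lemma k1_ge0 : \forall t \near F, 0 <= k1 t.
Proof. by apply: filterS2 eM2_ge0 regimeP => t e0 [_ _ s0 _]; rewrite divr_ge0// ltW. Qed.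

Lemma k2_ge0 : \forall t \near F, 0 <= k2 t.
Proof. by apply: filterS2 eM2_ge0 regimeP => t e0 [_ _ s0 _]; rewrite divr_ge0// sqr_ge0. Qed.

Lemma sg_ge0 : \forall t \near F, 0 <= sg t.
Proof. by apply: filterS regimeP => t [_ _ /ltW]. Qed.

Lemma eM_le_k1 : eM <~ k1.
Proof.
apply: (dominated_scale (q := fun _ r => r)) => [e r _ _ -> ->//||t *].
  exact: k1_ge0.
by field; rewrite !gt_eqF.
Qed.

Lemma k1_le_sg : k1 <~ sg.
Proof.
apply: (dominated_scale (q := fun e r => e * r)) => [e r e0 e1 r0 r1||t *].
- by rewrite mulr_ge0//= mulr_ile1.
- exact: sg_ge0.
by field; rewrite !gt_eqF.
Qed.

Lemma sg_le_M : sg <~ M.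
Proof. by apply: dominated_le; apply: filterS regimeP => t [_ _ /ltW -> ->]. Qed.

(** The comparison that uses the cube in full: the quotient of the two sides is eps kappa^3
    itself. *)
Lemma k2M_le_sg : (fun t => k2 t * M t) <~ sg.
Proof.
apply: (dominated_scale (q := fun e _ => e)) => [e r -> ->//||t *].
  exact: sg_ge0.
by field; rewrite !gt_eqF.
Qed.

Lemma k2_le_1 : k2 <~ (fun=> 1).
Proof.
apply: (dominated_scale (q := fun e r => e * r)) => [e r e0 e1 r0 r1||t *].
- by rewrite mulr_ge0//= mulr_ile1.
- by apply: nearW.
by field; rewrite !gt_eqF.
Qed.

Lemma dominated_scale_eq (g h : T -> R) : (\forall t \near F, 0 <= h t) ->
  (forall t, 0 < sg t -> 0 < M t -> g t = h t) -> g <~ h.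
Proof.
move=> h0 gh; apply: dominated_le; apply: filterS2 h0 regimeP => t h0 [_ _ s0 sM].
have M0 : 0 < M t by exact: lt_le_trans sM.
by rewrite gh// h0 lexx.
Qed.

Lemma dominated_mulmx_le m n r (A : T -> 'M[R]_(m, n)) (B : T -> 'M[R]_(n, r))
    (a b g : T -> R) : A <~ a -> B <~ b -> (fun t => a t * b t) <~ g ->
  (fun t => A t *m B t) <~ g.
Proof. by move=> Aa Bb; apply: dominated_trans; exact: dominated_mulmx. Qed.

Lemma dominated_gram_le1 m n (A : T -> 'M[R]_(m, n)) :
  (fun t => (A t)^T *m A t) <~ (fun=> 1) -> A <~ (fun=> 1).
Proof.
move=> [C C0 AC]; exists (C + 1); first exact: addr_ge0.
apply: filterS AC => t AC; rewrite -(@ler_pXn2r _ 2)// ?nnegrE ?mulr1 ?addr_ge0//.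
apply: le_trans (mx_norm_sqr _) _; apply: le_trans AC _.
by rewrite mulr1 expr2; have := mulr_ge0 C0 C0; lra.
Qed.

Lemma dominated_near_orthogonal m n (A : T -> 'M[R]_(m, n)) :
  (fun t => (A t)^T *m A t - 1%:M) <~ k2 -> A <~ (fun=> 1).
Proof.
move=> Ak; apply: dominated_gram_le1.
apply: dominated_eq (dominatedD (dominated_trans Ak k2_le_1)
  (dominated_cst (1%:M : 'M[R]_n))) => t.
by rewrite subrK.
Qed.

Lemma dominated_eps (K : R) (g h : T -> R) : g <~ h ->
  (fun t => K * eps t * g t) <~ (fun t => eps t * h t).
Proof.
move=> gh; apply: (@dominated_eq _ _ _ _ _ _ (fun t => K * (eps t * g t))).
  by move=> t; rewrite mulrA.
apply/dominatedZ/dominatedM => //; apply: dominated_refl.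
by apply: filterS regimeP => t [/ltW].
Qed.

Lemma dominated_fl_submulmx m n r (C W : T -> 'M[R]_(m, n)) (A : T -> 'M[R]_(m, r))
    (B : T -> 'M[R]_(r, n)) (a b g : T -> R) :
  (forall t, fl_submulmx (eps t) (C t) (A t) (B t) (W t)) ->
  C <~ g -> A <~ a -> B <~ b -> (fun t => a t * b t) <~ g ->
  (fun t => W t - (C t - A t *m B t)) <~ (fun t => eps t * g t).
Proof.
move=> CAB Cg Aa Bb abg.
have H : (fun t => `|C t| + `|A t| * `|B t|) <~ g.
  apply: dominatedD; first exact: dominated_norm.
  by apply: dominated_trans abg; apply: dominatedM; apply: dominated_norm.
apply: dominated_near (dominated_eps (2 ^+ r.+3 * r.+1%:R) H).
apply: filterS regimeP => t [/ltW e0 e1 _ _].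
exact: le_trans (fl_submulmx_error e0 e1 (CAB t)) (ler_norm _).
Qed.

Lemma dominated_fl_mulmx m n r (C : T -> 'M[R]_(m, n)) (A : T -> 'M[R]_(m, r))
    (B : T -> 'M[R]_(r, n)) (a b : T -> R) :
  (forall t, fl_mulmx (eps t) (A t) (B t) (C t)) -> A <~ a -> B <~ b ->
  (fun t => C t - A t *m B t) <~ (fun t => eps t * (a t * b t)).
Proof.
move=> ABC Aa Bb.
have H : (fun t => `|A t| * `|B t|) <~ (fun t => a t * b t).
  by apply: dominatedM; apply: dominated_norm.
apply: dominated_near (dominated_eps (2 ^+ r.+3 * r%:R) H).
apply: filterS regimeP => t [/ltW e0 e1 _ _].
exact: le_trans (fl_mulmx_error e0 e1 (ABC t)) (ler_norm _).
Qed.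

Lemma dominated_fl_addmx m n (A B C : T -> 'M[R]_(m, n)) g :
  (forall t, fl_addmx (eps t) (A t) (B t) (C t)) -> A <~ g -> B <~ g ->
  (fun t => C t - (A t + B t)) <~ (fun t => eps t * g t).
Proof.
move=> ABC Ag Bg.
have H : (fun t => `|A t| + `|B t|) <~ g.
  by apply: dominatedD; apply: dominated_norm.
apply: dominated_near (dominated_eps 1 H).
apply: filterS regimeP => t [/ltW e0 e1 _ _].
apply: le_trans (fl_addmx_error e0 (ABC t)) _.
by rewrite mul1r ler_norm.
Qed.

Lemma dominated_fl_batch (cB : R) m n r (A : T -> 'M[R]_(m, r))
    (B : T -> 'M[R]_(m, n)) (C : T -> 'M[R]_(r, n)) (a b : T -> R) :
  (forall t, fl_batch (eps t) cB (A t) (B t) (C t)) -> A <~ a -> B <~ b ->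
  (fun t => C t - (A t)^T *m B t) <~ (fun t => eps t * (a t * b t)).
Proof.
move=> ABC Aa Bb.
have H : (fun t => `|A t| * `|B t|) <~ (fun t => a t * b t).
  by apply: dominatedM; apply: dominated_norm.
(* The constant cB may be negative, hence its absolute value; the dimensions come from bounding both
   operator norms by max norms. *)
apply: dominated_near (dominated_eps (`|cB| * (m%:R * r%:R * (m%:R * n%:R))) H).
apply: filterS regimeP => t [/ltW e0 e1 _ _].
apply: le_trans (mx_norm_le_opnorm2 _) _; apply: le_trans (ABC t) _.
apply: le_trans (ler_norm _); rewrite -!mulrA.
apply: (@le_trans _ _ (`|cB| * (eps t * (opnorm2 (A t) * opnorm2 (B t))))).
  by rewrite ler_wpM2r ?ler_norm// !mulr_ge0 ?opnorm2_ge0.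
rewrite ler_wpM2l//.
have := ler_pM (opnorm2_ge0 (A t)) (opnorm2_ge0 (B t))
  (opnorm2_le_mx_norm (A t)) (opnorm2_le_mx_norm (B t)).
by move=> /(ler_wpM2l e0)/le_trans; apply; lra.
Qed.

(** U is W Y^-1 minus the residual times Y^-1. The residual bound contains |U|, with total
    coefficient O(eps |Y| |Y^-1|) = O(eps kappa), which is absorbed. The bound g on W Y^-1 is a
    separate hypothesis because |W| |Y^-1| can be larger by a factor kappa. *)
Lemma dominated_fl_trsm m n (W U : T -> 'M[R]_(m, n)) (Y : T -> 'M[R]_n) g :
  (forall t, fl_trsm (eps t) (W t) (Y t) (U t)) ->
  (forall t (i j : 'I_n), (j < i)%N -> Y t i j = 0) ->
  (\forall t \near F, forall j, Y t j j != 0) ->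
  (\forall t \near F, Y t \in unitmx) ->
  Y <~ M -> (fun t => invmx (Y t)) <~ isg ->
  (\forall t \near F, 0 <= g t) ->
  (fun t => W t *m invmx (Y t)) <~ g -> W <~ (fun t => M t * g t) ->
  U <~ g /\ (fun t => W t - U t *m Y t) <~ (fun t => eps t * (M t * g t)).
Proof.
move=> WYU Yup Yd Yu YM Yi g0 WYg WMg.
pose K : R := 2 ^+ n.+1.+4 * n.+1%:R.
have K0 : 0 <= K by apply: mulr_ge0 => //; exact: exprn_ge0.
have err : \forall t \near F, `|W t - U t *m Y t| <= K * eps t * (`|W t| + `|U t| * `|Y t|).
  apply: filterS2 regimeP Yd => t [/ltW e0 e1 _ _] Yd.
  exact: fl_trsm_error (Yup t) Yd (WYU t).
pose h t := `|W t *m invmx (Y t)| + n%:R * K * eps t * (`|W t| * `|invmx (Y t)|).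
pose d t := n%:R * K * eps t * (`|Y t| * `|invmx (Y t)|).
have Ug : U <~ g.
  apply: (@dominated_absorb _ _ _ _ _ _ h d).
  - apply: filterS3 err Yu regimeP => t err Yu [e0 _ _ _].
    have {1}-> : U t = W t *m invmx (Y t) - (W t - U t *m Y t) *m invmx (Y t).
      by rewrite mulmxBl mulmxK// opprB addrC subrK.
    apply: le_trans (ler_normB _ _) _; rewrite /h -addrA lerD2l.
    apply: le_trans (mx_norm_mul _ _) _.
    have := ler_wpM2r (normr_ge0 (invmx (Y t))) err.
    move=> /(ler_wpM2l (ler0n R n)); rewrite mulrA => /le_trans; apply.
    rewrite /d; lra.
  - have [C C0 dC] : d <~ (fun t => eps t * (M t * isg t)).
      by apply: dominated_eps; apply: dominatedM; apply: dominated_norm.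
    have C1 : 0 < 1 / 2 / (C + 1) :> R by rewrite !divr_gt0// ltr_wpDl.
    apply: filterS3 dC (regime_small1 C1) regimeP => t dC sm [e0 e1 s0 sM].
    have M0 : 0 < M t by exact: lt_le_trans sM.
    apply: le_trans (ler_norm _) _; apply: le_trans dC _.
    move: sm; rewrite -ler_pdivrMr// !mulrA ler_pdivlMr ?ltr_wpDl// => sm.
    have : 0 <= eps t * M t / sg t by rewrite divr_ge0 ?mulr_ge0// ltW.
    lra.
  - apply: dominatedD; first exact: dominated_norm.
    apply: (@dominated_trans _ _ _ _ _ _ (fun t => eps t * (M t * g t * isg t))).
      by apply: dominated_eps; apply: dominatedM; apply: dominated_norm.
    apply: dominated_le; apply: filterS3 g0 regimeP (regime_small1 ltr01).
    move=> t g0 [e0 e1 s0 sM]; rewrite mul1r => sm.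
    have M0 : 0 < M t by exact: lt_le_trans sM.
    rewrite !mulrA; apply/andP; split.
      by rewrite !mulr_ge0 ?invr_ge0// ltW.
    by rewrite ler_pdivrMr// mulrC ler_wpM2l.
split=> //.
have H : (fun t => `|W t| + `|U t| * `|Y t|) <~ (fun t => M t * g t).
  apply: dominatedD; first exact: dominated_norm.
  apply: (@dominated_trans _ _ _ _ _ _ (fun t => g t * M t)).
    by apply: dominatedM; apply: dominated_norm.
  apply: dominated_le; apply: filterS2 g0 M_ge0 => t g0 M0.
  by rewrite mulr_ge0//= mulrC.
apply: dominated_near (dominated_eps K H).
by apply: filterS err => t /le_trans; apply; exact: ler_norm.
Qed.

(** * One step of the algorithm *)

Section Reorthogonalization.
Variables (m r s : nat) (c : R).
Variables (A : T -> 'M[R]_(m, r)) (X V W Q : T -> 'M[R]_(m, s)).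
Variables (S Y Rb : T -> 'M[R]_(r, s)) (Om G U : T -> 'M[R]_s).
Hypothesis c_gt0 : 0 < c.
Hypothesis orthA : (fun t => (A t)^T *m A t - 1%:M) <~ k2.
Hypothesis XM : X <~ M.
Hypothesis coerciveX : \forall t \near F, forall (x : 'cV_s) (y : 'cV_r),
  c * sg t * `|x| <= `|X t *m x - A t *m y|.
Hypothesis SX : (fun t => S t - (A t)^T *m X t) <~ k1.
Hypothesis VX : (fun t => V t - (X t - A t *m S t)) <~ eM.

Let A1 : A <~ (fun=> 1). Proof. exact: dominated_near_orthogonal. Qed.

Let mulA1 n1 n2 n3 (B : T -> 'M[R]_(n1, n2)) (D : T -> 'M[R]_(n2, n3)) g :
  (\forall t \near F, 0 <= g t) -> B <~ (fun=> 1) -> D <~ g ->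
  (fun t => B t *m D t) <~ g.
Proof.
move=> g0 B1 Dg; apply: dominated_mulmx_le B1 Dg _.
by apply: dominated_le; apply: filterS g0 => t g0; rewrite mul1r g0 lexx.
Qed.

Let At1 : (fun t => (A t)^T) <~ (fun=> 1). Proof. exact: dominated_trmx. Qed.

Let k1_le_M : k1 <~ M. Proof. exact: dominated_trans k1_le_sg sg_le_M. Qed.
Let eM_le_sg : eM <~ sg. Proof. exact: dominated_trans eM_le_k1 k1_le_sg. Qed.
Let eM_le_M : eM <~ M. Proof. exact: dominated_trans eM_le_sg sg_le_M. Qed.

Lemma first_pass_coef_bound : S <~ M.
Proof.
have AX : (fun t => (A t)^T *m X t) <~ M by apply: mulA1 => //; exact: M_ge0.
apply: dominated_eq (dominatedD (dominated_trans SX k1_le_M) AX) => t.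
by rewrite subrK.
Qed.

Let SM := first_pass_coef_bound.

Lemma first_pass_bound : V <~ M.
Proof.
have AS : (fun t => A t *m S t) <~ M by apply: mulA1 => //; exact: M_ge0.
apply: dominated_eq (dominatedD (dominated_trans VX eM_le_M) (dominatedB XM AS)) => t.
by rewrite subrK.
Qed.

Let VM := first_pass_bound.

(** Of the three contributions, the defect of A times S has the largest scale, eps kappa^2 M. *)
Let AV : (fun t => (A t)^T *m V t) <~ sg.
Proof.
have e1 : (fun t => (A t)^T *m (V t - (X t - A t *m S t))) <~ sg.
  by apply: dominated_trans eM_le_sg; apply: mulA1 => //; exact: eM_ge0.
have e2 : (fun t => ((A t)^T *m A t - 1%:M) *m S t) <~ sg.
  exact: dominated_mulmx_le orthA SM k2M_le_sg.
apply: dominated_eq (dominatedB (dominatedB e1 e2) (dominated_trans SX k1_le_sg)) => t.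
by mx_lin.
Qed.

Hypothesis YV : (fun t => Y t - (A t)^T *m V t) <~ eM.
Hypothesis OmV : (fun t => Om t - (V t)^T *m V t) <~ eM2.
Hypothesis WE : forall t, fl_submulmx (eps t) (V t) (A t) (Y t) (W t).
Hypothesis GE : forall t, fl_submulmx (eps t) (Om t) (Y t)^T (Y t) (G t).
Hypothesis UE : forall t, fl_chol (eps t) (G t) (U t).
Hypothesis QE : forall t, fl_trsm (eps t) (W t) (U t) (Q t).
Hypothesis RbE : forall t, fl_addmx (eps t) (S t) (Y t) (Rb t).

Let Ysg : Y <~ sg.
Proof.
by apply: dominated_eq (dominatedD (dominated_trans YV eM_le_sg) AV) => t; rewrite subrK.
Qed.

Lemma second_pass_coef_bound : Y <~ M.
Proof. exact: dominated_trans Ysg sg_le_M. Qed.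

Let YM := second_pass_coef_bound.

Let WV : (fun t => W t - (V t - A t *m Y t)) <~ eM.
Proof.
apply: (dominated_fl_submulmx WE VM A1 YM).
by apply: dominated_scale_eq => [|t _ _]; [exact: M_ge0|rewrite mul1r].
Qed.

Let VAY : (fun t => V t - A t *m Y t) <~ M.
Proof. by apply: dominatedB => //; apply: mulA1 => //; exact: M_ge0. Qed.

Let WM : W <~ M.
Proof.
by apply: dominated_eq (dominatedD (dominated_trans WV eM_le_M) VAY) => t; rewrite subrK.
Qed.

Let M2_ge0 : \forall t \near F, 0 <= M t ^+ 2.
Proof. by apply: nearW => t; exact: sqr_ge0. Qed.

(** Expanding the Gram matrix of V - A Y gives V^T V - Y^T Y plus terms containing Y - A^T V or A^T
    A - I. *)
Let GW : (fun t => G t - (W t)^T *m W t) <~ eM2.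
Proof.
have OmM : Om <~ (fun t => M t ^+ 2).
  have VV : (fun t => (V t)^T *m V t) <~ (fun t => M t ^+ 2).
    apply: dominated_mulmx_le (dominated_trmx VM) VM _.
    by apply: dominated_scale_eq => // t _ _; rewrite expr2.
  by apply: dominated_eq (dominatedD (dominated_trans OmV eM2_le_M2) VV) => t; rewrite subrK.
have GOm : (fun t => G t - (Om t - (Y t)^T *m Y t)) <~ eM2.
  apply: (dominated_fl_submulmx GE OmM (dominated_trmx YM) YM).
  by apply: dominated_scale_eq => // t _ _; rewrite expr2.
have eMM (B D : T -> 'M[R]_(m, s)) : B <~ eM -> D <~ M ->
    (fun t => (B t)^T *m D t) <~ eM2.
  move=> Be DM; apply: dominated_mulmx_le (dominated_trmx Be) DM _.
  by apply: dominated_scale_eq => [|t _ _]; [exact: eM2_ge0|ring].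
have WW : (fun t => (W t)^T *m W t - (V t - A t *m Y t)^T *m (V t - A t *m Y t)) <~ eM2.
  apply: dominated_eq (dominatedD (eMM _ _ WV WM) (dominated_trmx (eMM _ _ WV VAY))) => t.
  by mx_lin.
have YYV : (fun t => (Y t)^T *m (Y t - (A t)^T *m V t)) <~ eM2.
  apply: dominated_mulmx_le (dominated_trmx YM) YV _.
  by apply: dominated_scale_eq => [|t _ _]; [exact: eM2_ge0|ring].
(* Here Y = O(sg) is essential: the two factors sg cancel the denominator of [k2]. *)
have YAY : (fun t => (Y t)^T *m ((A t)^T *m A t - 1%:M) *m Y t) <~ eM2.
  apply: dominated_mulmx_le (dominated_mulmx (dominated_trmx Ysg) orthA) Ysg _.
  apply: dominated_scale_eq => [|t s0 M0]; first exact: eM2_ge0.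
  by field; rewrite gt_eqF.
apply: dominated_eq (dominatedB (dominatedD GOm OmV)
  (dominatedD WW (dominatedD (dominatedD YYV (dominated_trmx YYV)) YAY))) => t.
by mx_lin.
Qed.

Let W_coercive : \forall t \near F, forall x : 'cV_s,
  c / 2 * sg t * `|x| <= `|W t *m x|.
Proof.
have [C C0 EC] : (fun t => W t - (X t - A t *m (S t + Y t))) <~ eM.
  by apply: dominated_eq (dominatedD WV VX) => t; mx_lin.
have c1 : 0 < c / 2 / (s%:R * C + 1) by rewrite !divr_gt0// ltr_wpDl// mulr_ge0.
have small : \forall t \near F, s%:R * (C * (eps t * M t)) <= c / 2 * sg t.
  apply: filterS2 eM_ge0 (regime_small1 c1) => t e0.
  by rewrite mulrAC ler_pdivlMr; [lra|rewrite ltr_wpDl// mulr_ge0].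
apply: filterS3 coerciveX EC small => t cX EC sm x.
set E := W t - _ in EC.
have -> : W t *m x = (X t *m x - A t *m ((S t + Y t) *m x)) + E *m x by rewrite /E; mx_lin.
have Ex : `|E *m x| <= c / 2 * sg t * `|x|.
  apply: le_trans (mx_norm_mul _ _) _; rewrite ler_wpM2r//.
  by apply: le_trans sm; rewrite ler_wpM2l.
have := cX x ((S t + Y t) *m x).
set u := X t *m x - _; have := ler_normD (u + E *m x) (- (E *m x)).
rewrite addrK normrN; lra.
Qed.

Let H t := (W t)^T *m W t.

Let H_pos : \forall t \near F, forall x : 'cV_s,
  (c / 2) ^+ 2 * sg t ^+ 2 * `|x| ^+ 2 <= (x^T *m H t *m x) 0 0.
Proof.
apply: filterS2 W_coercive regimeP => t Wc [_ _ s0 _] x.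
have -> : x^T *m H t *m x = (W t *m x)^T *m (W t *m x) by rewrite /H; mx_lin.
rewrite -sqr_norm2 -!exprMn ler_pXn2r ?nnegrE ?norm2_ge0//.
  exact: le_trans (Wc x) (mx_norm_le_norm2 _).
by rewrite !mulr_ge0// ?ltW// divr_gt0.
Qed.

Let U_stable : [/\ \forall t \near F, forall j, 0 < U t j j, U <~ M &
  (fun t => (U t)^T *m U t - H t) <~ eM2].
Proof.
apply: (@fl_chol_stable _ G H U ((c / 2) ^+ 2)).
- by rewrite exprn_gt0// divr_gt0.
- by apply: nearW.
- by apply: nearW => t; rewrite /H; mx_lin.
- exact: H_pos.
- exact: GW.
- apply: dominated_mulmx_le (dominated_trmx WM) WM _.
  by apply: dominated_scale_eq => // t _ _; rewrite expr2.
Qed.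

Let U_coercive : \forall t \near F, forall x : 'cV_s,
  c / 4 / s.+1%:R * sg t * `|x| <= `|U t *m x|.
Proof.
have [_ _ UH] := U_stable.
have q0 : 0 < s.+1%:R :> R by rewrite ltr0n.
have sq : s%:R <= s.+1%:R :> R by rewrite ler_nat.
(* The factor s is the cost of comparing the 2-norm with the max norm; its successor can be divided
   by. Below, (c / 2)^2 - c^2 / 8 still exceeds (c / 4)^2. *)
move: (s.+1%:R : R) q0 sq => q q0 sq.
have c8 : 0 < c ^+ 2 / 8 / q ^+ 2 by rewrite !divr_gt0 ?exprn_gt0.
apply: filterS3 H_pos (dominated_small c8 UH) regimeP => t Hp sm [_ _ s0 _] x.
have := Hp x.
have -> : x^T *m H t *m x = (U t *m x)^T *m (U t *m x) - x^T *m ((U t)^T *m U t - H t) *m x.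
  by mx_lin.
set D := _ - H t in sm *.
rewrite mxE [X in _ + X]mxE -sqr_norm2 => Hx.
have := mx_norm_quad D x; rewrite ler_norml => /andP[qD _].
have sx : s%:R ^+ 2 * `|D| * `|x| ^+ 2 <= c ^+ 2 / 8 * sg t ^+ 2 * `|x| ^+ 2.
  rewrite ler_wpM2r ?sqr_ge0//.
  apply: (@le_trans _ _ (q ^+ 2 * `|D|)).
    by rewrite ler_wpM2r// ler_pXn2r ?nnegrE// ltW.
  have := ler_wpM2l (sqr_ge0 q) sm => /le_trans; apply.
  by rewrite le_eqVlt; apply/orP; left; apply/eqP; field; rewrite gt_eqF.
have cx0 : 0 <= c / 4 * sg t * `|x| by rewrite !mulr_ge0// ?ltW// divr_gt0.
have Ux : c / 4 * sg t * `|x| <= norm2 (U t *m x).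
  rewrite -(@ler_pXn2r _ 2)// ?nnegrE ?norm2_ge0// !exprMn.
  have := mulr_ge0 (mulr_ge0 (sqr_ge0 c) (sqr_ge0 (sg t))) (sqr_ge0 `|x|).
  rewrite !exprVn; lra.
have -> : c / 4 / q * sg t * `|x| = c / 4 * sg t * `|x| / q by field; rewrite gt_eqF.
rewrite ler_pdivrMr// [leRHS]mulrC; apply: le_trans Ux _.
apply: le_trans (norm2_le_mx_norm _) _.
by rewrite ler_wpM2r.
Qed.

Let U_inv : (\forall t \near F, U t \in unitmx) /\ (fun t => invmx (U t)) <~ isg.
Proof.
have c4 : 0 < c / 4 / s.+1%:R by rewrite !divr_gt0.
have H0 : \forall t \near F, U t \in unitmx /\ `|invmx (U t)| <= (c / 4 / s.+1%:R * sg t)^-1.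
  apply: filterS2 U_coercive regimeP => t Uc [_ _ s0 _].
  by apply: coercive_unitmx => //; rewrite mulr_gt0.
split; first by apply: filterS H0 => t [].
exists (c / 4 / s.+1%:R)^-1; first by rewrite invr_ge0 ltW.
by apply: filterS H0 => t [_]; rewrite invfM.
Qed.

Lemma second_pass_factor_diag : \forall t \near F, forall j, U t j j != 0.
Proof.
by have [Up _ _] := U_stable; apply: filterS Up => t Up j; rewrite gt_eqF.
Qed.

Let Uup t (i j : 'I_s) : (j < i)%N -> U t i j = 0.
Proof. by have [Uup _ _] := UE t; exact: Uup. Qed.

(** The origin of the scale eps kappa^2: an error eps M^2 between two factors 1 / sg. *)
Let congrU (B : T -> 'M[R]_s) : B <~ eM2 ->
  (fun t => (invmx (U t))^T *m B t *m invmx (U t)) <~ k2.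
Proof.
move=> Be; have [Uu Ui] := U_inv.
apply: dominated_mulmx_le (dominated_mulmx (dominated_trmx Ui) Be) Ui _.
by apply: dominated_scale_eq => [|t s0 _]; [exact: k2_ge0|field; rewrite gt_eqF].
Qed.

(** Identities that cancel U against its inverse hold only where U is invertible, that is, near
    F. *)
Let near_eq (n1 n2 : nat) (B D : T -> 'M[R]_(n1, n2)) g :
  (\forall t \near F, B t = D t) -> D <~ g -> B <~ g.
Proof. by move=> BD; apply: dominated_near; apply: filterS BD => t ->. Qed.

(** Bounding W U^-1 by the product of the norms would lose a factor kappa. Its Gram matrix is I -
    U^-T (U^T U - W^T W) U^-1, which is bounded. *)
Let QW : Q <~ (fun=> 1) /\ (fun t => W t - Q t *m U t) <~ eM.
Proof.
have [Up UM UH] := U_stable; have [Uu Ui] := U_inv.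
have WU : (fun t => W t *m invmx (U t)) <~ (fun=> 1).
  apply: dominated_gram_le1; apply: (@near_eq _ _ _ (fun t => 1%:M -
      (invmx (U t))^T *m ((U t)^T *m U t - H t) *m invmx (U t))).
    apply: filterS Uu => t Uu.
    have -> : (invmx (U t))^T *m ((U t)^T *m U t - H t) *m invmx (U t) =
        (U t *m invmx (U t))^T *m (U t *m invmx (U t))
        - (W t *m invmx (U t))^T *m (W t *m invmx (U t)).
      by mx_lin.
    by rewrite mulmxV// trmx1 mul1mx opprB addrC subrK.
  apply: dominatedB; first exact: dominated_cst.
  exact: dominated_trans (congrU UH) k2_le_1.
have one_ge0 : \forall t \near F, 0 <= 1 :> R by exact: nearW.
have WM1 : W <~ (fun t => M t * 1).
  apply: dominated_trans WM _; apply: dominated_scale_eq => [|t _ _].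
    by apply: filterS M_ge0 => t; rewrite mulr1.
  by rewrite mulr1.
have [Q1 QU] :=
  dominated_fl_trsm QE Uup second_pass_factor_diag Uu UM Ui one_ge0 WU WM1.
split=> //; apply: dominated_trans QU _.
by apply: dominated_scale_eq => [|t _ _]; [exact: eM_ge0|rewrite mulr1].
Qed.

Let QU_M : (fun t => Q t *m U t) <~ M.
Proof.
have [_ WQ] := QW.
by apply: dominated_eq (dominatedB WM (dominated_trans WQ eM_le_M)) => t; rewrite opprB addrC subrK.
Qed.

Lemma second_pass_orthonormal : (fun t => (Q t)^T *m Q t - 1%:M) <~ k2.
Proof.
have [Up UM UH] := U_stable; have [Uu Ui] := U_inv; have [Q1 WQ] := QW.
have eMM (B D : T -> 'M[R]_(m, s)) : B <~ eM -> D <~ M ->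
    (fun t => (B t)^T *m D t) <~ eM2.
  move=> Be DM; apply: dominated_mulmx_le (dominated_trmx Be) DM _.
  by apply: dominated_scale_eq => [|t _ _]; [exact: eM2_ge0|ring].
have D0 : (fun t => (Q t *m U t)^T *m (Q t *m U t) - (U t)^T *m U t) <~ eM2.
  apply: dominated_eq (dominatedN (dominatedD (dominatedD UH (eMM _ _ WQ WM))
    (dominated_trmx (eMM _ _ WQ QU_M)))) => t.
  by rewrite /H; mx_lin.
apply: near_eq (congrU D0); apply: filterS Uu => t Uu.
have -> : (invmx (U t))^T *m ((Q t *m U t)^T *m (Q t *m U t) - (U t)^T *m U t) *m invmx (U t) =
    (Q t *m (U t *m invmx (U t)))^T *m (Q t *m (U t *m invmx (U t)))
    - (U t *m invmx (U t))^T *m (U t *m invmx (U t)) by mx_lin.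
by rewrite mulmxV// mulmx1 trmx1 mul1mx.
Qed.

(** First A^T (Q U) = O(eps kappa M), where the defect of A is met only by Y = O(sg); then U^-1
    costs 1 / sg. *)
Lemma second_pass_orthogonal : (fun t => (A t)^T *m Q t) <~ k2.
Proof.
have [Uu Ui] := U_inv; have [Q1 WQ] := QW.
have A_eM (B : T -> 'M[R]_(m, s)) : B <~ eM -> (fun t => (A t)^T *m B t) <~ k1.
  by move=> Be; apply: dominated_trans eM_le_k1; apply: mulA1 => //; exact: eM_ge0.
have AAY : (fun t => ((A t)^T *m A t - 1%:M) *m Y t) <~ k1.
  apply: dominated_mulmx_le orthA Ysg _.
  by apply: dominated_scale_eq => [|t s0 _]; [exact: k1_ge0|field; rewrite gt_eqF].
have AQU : (fun t => (A t)^T *m (Q t *m U t)) <~ k1.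
  apply: dominated_eq (dominatedB (dominatedB (dominatedB (A_eM _ WV) (A_eM _ WQ))
    (dominated_trans YV eM_le_k1)) AAY) => t.
  by mx_lin.
apply: (@near_eq _ _ _ (fun t => (A t)^T *m (Q t *m U t) *m invmx (U t))).
  by apply: filterS Uu => t Uu; rewrite !mulmxA mulmxK.
apply: dominated_mulmx_le AQU Ui _.
by apply: dominated_scale_eq => [|t s0 _]; [exact: k2_ge0|field; rewrite gt_eqF].
Qed.

Lemma second_pass_residual : (fun t => V t - (A t *m Y t + Q t *m U t)) <~ eM.
Proof.
have [_ WQ] := QW; apply: dominated_eq (dominatedB WQ WV) => t.
by mx_lin.
Qed.

Lemma block_residual : (fun t => X t - (A t *m Rb t + Q t *m U t)) <~ eM.
Proof.
have RSY : (fun t => A t *m (Rb t - (S t + Y t))) <~ eM.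
  apply: mulA1 => //; first exact: eM_ge0.
  exact: dominated_fl_addmx RbE SM YM.
apply: dominated_eq (dominatedB (dominatedB second_pass_residual VX) RSY) => t.
by mx_lin.
Qed.

Lemma reorthogonalization_stable :
  [/\ (fun t => X t - (A t *m Rb t + Q t *m U t)) <~ eM,
      (fun t => (A t)^T *m Q t) <~ k2,
      (fun t => (Q t)^T *m Q t - 1%:M) <~ k2
    & \forall t \near F, U t \in unitmx].
Proof.
split; [exact: block_residual|exact: second_pass_orthogonal|
  exact: second_pass_orthonormal|exact: U_inv.1].
Qed.

Section NextCoefficient.
Variables (X' : T -> 'M[R]_(m, s)) (Z : T -> 'M[R]_(r, s)) (P G' S' : T -> 'M[R]_s).
Hypothesis X'M : X' <~ M.
Hypothesis ZX : (fun t => Z t - (A t)^T *m X' t) <~ eM.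
Hypothesis PX : (fun t => P t - (V t)^T *m X' t) <~ eM2.
Hypothesis G'E : forall t, fl_submulmx (eps t) (P t) (Y t)^T (Z t) (G' t).
Hypothesis S'E : forall t, fl_trsm (eps t) (G' t)^T (U t) (S' t)^T.

(** The algorithm never forms Q^T X'. But P - Y^T Z is (V - A Y)^T X' up to O(eps M^2), and V - A Y
    is Q U up to O(eps M); solving with U then costs 1 / sg. *)
Lemma next_first_pass_coef : (fun t => S' t - (Q t)^T *m X' t) <~ k1.
Proof.
have [Up UM UH] := U_stable; have [Uu Ui] := U_inv; have [Q1 WQ] := QW.
have ZM : Z <~ M.
  have AX' : (fun t => (A t)^T *m X' t) <~ M by apply: mulA1 => //; exact: M_ge0.
  by apply: dominated_eq (dominatedD (dominated_trans ZX eM_le_M) AX') => t; rewrite subrK.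
have mulMM n1 n2 n3 (B : T -> 'M[R]_(n1, n2)) (D : T -> 'M[R]_(n2, n3)) :
    B <~ M -> D <~ M -> (fun t => B t *m D t) <~ (fun t => M t ^+ 2).
  move=> BM DM; apply: dominated_mulmx_le BM DM _.
  by apply: dominated_scale_eq => // t _ _; rewrite expr2.
have PM : P <~ (fun t => M t ^+ 2).
  have VX' : (fun t => (V t)^T *m X' t) <~ (fun t => M t ^+ 2).
    by apply: mulMM X'M; exact: dominated_trmx.
  by apply: dominated_eq (dominatedD (dominated_trans PX eM2_le_M2) VX') => t; rewrite subrK.
have G'P : (fun t => G' t - (P t - (Y t)^T *m Z t)) <~ eM2.
  apply: (dominated_fl_submulmx G'E PM (dominated_trmx YM) ZM).
  by apply: dominated_scale_eq => // t _ _; rewrite expr2.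
have G'Q : (fun t => G' t - (Q t *m U t)^T *m X' t) <~ eM2.
  have YZ : (fun t => (Y t)^T *m (Z t - (A t)^T *m X' t)) <~ eM2.
    apply: dominated_mulmx_le (dominated_trmx YM) ZX _.
    by apply: dominated_scale_eq => [|t _ _]; [exact: eM2_ge0|ring].
  have VX' : (fun t => (V t - (A t *m Y t + Q t *m U t))^T *m X' t) <~ eM2.
    apply: dominated_mulmx_le (dominated_trmx second_pass_residual) X'M _.
    by apply: dominated_scale_eq => [|t _ _]; [exact: eM2_ge0|ring].
  apply: dominated_eq (dominatedD (dominatedB (dominatedD G'P PX) YZ) VX') => t.
  by mx_lin.
have G'M : G' <~ (fun t => M t ^+ 2).
  have QUX : (fun t => (Q t *m U t)^T *m X' t) <~ (fun t => M t ^+ 2).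
    by apply: mulMM X'M; exact: dominated_trmx.
  by apply: dominated_eq (dominatedD (dominated_trans G'Q eM2_le_M2) QUX) => t; rewrite subrK.
have D1 : (fun t => (G' t - (Q t *m U t)^T *m X' t)^T *m invmx (U t)) <~ k1.
  apply: dominated_mulmx_le (dominated_trmx G'Q) Ui _.
  by apply: dominated_scale_eq => [|t s0 _]; [exact: k1_ge0|].
(* As for Q, the exact solution is bounded through its limit X'^T Q, not by |G'| |U^-1|, which would
   be O(kappa M). *)
have XQ : (fun t => (X' t)^T *m Q t) <~ M.
  apply: dominated_mulmx_le (dominated_trmx X'M) Q1 _.
  by apply: dominated_scale_eq => [|t _ _]; [exact: M_ge0|rewrite mulr1].
have G'U_eq : \forall t \near F, (G' t)^T *m invmx (U t) =
    (G' t - (Q t *m U t)^T *m X' t)^T *m invmx (U t) + (X' t)^T *m Q t.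
  apply: filterS Uu => t Uu.
  have -> : (X' t)^T *m Q t = (X' t)^T *m (Q t *m (U t *m invmx (U t))).
    by rewrite mulmxV// mulmx1.
  by mx_lin.
have G'U : (fun t => (G' t)^T *m invmx (U t)) <~ M.
  by apply: near_eq G'U_eq _; apply: dominatedD => //; exact: dominated_trans D1 k1_le_M.
have [S'M S'G'] := dominated_fl_trsm S'E Uup second_pass_factor_diag Uu UM Ui M_ge0 G'U
  (dominated_trmx G'M).
have D2 : (fun t => ((G' t)^T - (S' t)^T *m U t) *m invmx (U t)) <~ k1.
  apply: dominated_mulmx_le S'G' Ui _.
  by apply: dominated_scale_eq => [|t s0 _]; [exact: k1_ge0|rewrite expr2].
apply: near_eq (dominated_trmx (dominatedB D1 D2)).
apply: filterS2 Uu G'U_eq => t Uu GU.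
rewrite [((G' t)^T - _) *m _]mulmxBl mulmxK// GU.
by mx_lin.
Qed.

End NextCoefficient.
End Reorthogonalization.

(** * The run of the algorithm *)

Section Blocks.
Variables m s : nat.
Implicit Types (k : nat) (g : T -> R).

Lemma dominated_brow k (Q : T -> nat -> 'M[R]_(m, s)) g :
  (\forall t \near F, 0 <= g t) ->
  (forall j, (j < k)%N -> (fun t => Q t j) <~ g) -> (fun t => brow k (Q t)) <~ g.
Proof.
move=> g0 Qg; apply: dominated_mx => // i j.
apply: dominated_eq (dominated_coef i (tagnat.sig2 j) (Qg _ (ltn_ord (tagnat.sig1 j)))) => t.
by rewrite mxE.
Qed.

Lemma dominated_bcol k (S : T -> nat -> nat -> 'M[R]_s) j g :
  (\forall t \near F, 0 <= g t) ->
  (forall i, (i < k)%N -> (fun t => S t i j) <~ g) -> (fun t => bcol k (S t) j) <~ g.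
Proof.
move=> g0 Sg; apply: dominated_mx => // i l.
apply: dominated_eq (dominated_coef (tagnat.sig2 i) l (Sg _ (ltn_ord (tagnat.sig1 i)))) => t.
by rewrite mxE.
Qed.

Lemma tr_brow_mul k (Q : nat -> 'M[R]_(m, s)) (B : 'M[R]_(m, s)) :
  (brow k Q)^T *m B = bcol k (fun i _ => (Q i)^T *m B) 0.
Proof. by rewrite /brow tr_mxrow mxcol_mul. Qed.

Lemma brow_bcol k (Q : nat -> 'M[R]_(m, s)) (S : nat -> nat -> 'M[R]_s) j :
  brow k Q *m bcol k S j = \sum_(i < k) Q i *m S i j.
Proof. by rewrite mul_mxrow_mxcol. Qed.

Lemma dominated_bcol_coef k (S : T -> nat -> nat -> 'M[R]_s) j i g :
  (\forall t \near F, 0 <= g t) -> (i < k)%N ->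
  (fun t => bcol k (S t) j) <~ g -> (fun t => S t i j) <~ g.
Proof.
move=> g0 ik Sg; apply: dominated_mx => // a b.
apply: dominated_eq (dominated_coef (tagnat.Rank (Ordinal ik) a) b Sg) => t.
by have /matrixP/(_ a b) := mxcolK (fun i0 : 'I_k => S t i0 j) (Ordinal ik); rewrite !mxE.
Qed.

Lemma dominated_gram_brow k (Q : T -> nat -> 'M[R]_(m, s)) g :
  (\forall t \near F, 0 <= g t) ->
  (forall i j, (i < k)%N -> (j < k)%N ->
    (fun t => (Q t i)^T *m Q t j - (i == j)%:R%:M) <~ g) ->
  (fun t => (brow k (Q t))^T *m brow k (Q t) - 1%:M) <~ g.
Proof.
move=> g0 Qg; apply: dominated_mx => // a b.
set i := tagnat.sig1 a; set j := tagnat.sig1 b.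
apply: dominated_eq (dominated_coef (tagnat.sig2 a) (tagnat.sig2 b)
  (Qg _ _ (ltn_ord i) (ltn_ord j))) => t.
have -> : (brow k (Q t))^T *m brow k (Q t) =
    \mxblock_(i < k, j < k) ((Q t i)^T *m Q t j).
  by rewrite /brow tr_mxrow mul_mxcol_mxrow.
rewrite [LHS]mxE [RHS]mxE; congr (_ + _); first by rewrite mxE.
rewrite [LHS]mxE [RHS]mxE [in LHS]mxE [in RHS]mxE; congr (- _).
have ab : (a == b) = (i == j) && (tagnat.sig2 a == tagnat.sig2 b).
  by have := tagnat.eq_Rank (tagnat.sig2 a) (tagnat.sig2 b); rewrite !tagnat.sig2K.
rewrite ab -val_eqE; case: (val i == val j) => //=.
by case: (tagnat.sig2 a == tagnat.sig2 b); rewrite ?mul0rn.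
Qed.

End Blocks.

(** Solve for the last coefficient and subtract its share from the earlier ones. No bound on z is
    claimed; coercivity will supply one. *)
Lemma block_back_substitution m s k (Q : nat -> 'M[R]_(m, s))
    (Rb : nat -> nat -> 'M[R]_s) (y : nat -> 'cV[R]_s) :
  (forall j, (j < k)%N -> Rb j j \in unitmx) ->
  exists z : nat -> 'cV[R]_s, \sum_(i < k) Q i *m y i =
    \sum_(j < k) (brow j Q *m bcol j Rb j + Q j *m Rb j j) *m z j.
Proof.
elim: k y => [|k IH] y Ru; first by exists (fun=> 0); rewrite !big_ord0.
pose zk := invmx (Rb k k) *m y k.
have [z Qz] := IH (fun i => y i - Rb i k *m zk) (fun j jk => Ru j (ltnW jk)).
exists (fun j => if j == k then zk else z j).
rewrite !big_ord_recr/= eqxx mulmxDl brow_bcol -mulmxA mulKVmx ?Ru// addrA.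
congr (_ + _).
have -> : \sum_(j < k) (brow j Q *m bcol j Rb j + Q j *m Rb j j) *m
    (if j == k :> nat then zk else z j) =
    \sum_(j < k) (brow j Q *m bcol j Rb j + Q j *m Rb j j) *m z j.
  by apply: eq_bigr => j _; rewrite ltn_eqF.
rewrite -Qz mulmx_suml -big_split/=; apply: eq_bigr => i _.
by rewrite mulmxBr mulmxA subrK.
Qed.

(** * Induction over the blocks *)

Section Run.
Variables (m s p : nat) (cB c : R).
Variables (X Q V : T -> nat -> 'M[R]_(m, s)) (Om P : T -> nat -> 'M[R]_s).
Variables (S Y Rb : T -> nat -> nat -> 'M[R]_s).
Variable Z : T -> forall k, 'M[R]_(\sum_(i < k) s, s).
Hypothesis c_gt0 : 0 < c.
Hypothesis XM : forall j, (j < p)%N -> (fun t => X t j) <~ M.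
Hypothesis X_coercive : \forall t \near F, forall (w : nat -> 'cV[R]_s) l, (l < p)%N ->
  c * sg t * `|w l| <= `|\sum_(j < p) X t j *m w j|.
Hypothesis X0 : (fun t => X t 0%N - Q t 0%N *m Rb t 0%N 0%N) <~ eM.
Hypothesis Q0 : (fun t => (Q t 0%N)^T *m Q t 0%N - 1%:M) <~ k2.
Hypothesis first : forall t, (1 < p)%N ->
  fl_mulmx (eps t) (Q t 0%N)^T (X t 1%N) (S t 0%N 1%N) /\
  fl_submulmx (eps t) (X t 1%N) (Q t 0%N) (S t 0%N 1%N) (V t 1%N).
Hypothesis second : forall t k, (0 < k)%N -> (k < p)%N ->
  [/\ fl_batch (eps t) cB (brow k (Q t)) (V t k) (bcol k (Y t) k),
      fl_batch (eps t) cB (V t k) (V t k) (Om t k)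
    & reorthogonalize (eps t) k (V t) (Om t) (S t) (Y t) (Q t) (Rb t)].
Hypothesis next : forall t k, (0 < k)%N -> (k.+1 < p)%N ->
  [/\ fl_batch (eps t) cB (brow k (Q t)) (X t k.+1) (Z t k),
      fl_batch (eps t) cB (V t k) (X t k.+1) (P t k),
      bcol k (S t) k.+1 = Z t k,
      exists2 G, fl_submulmx (eps t) (P t k) (bcol k (Y t) k)^T (Z t k) G
               & fl_trsm (eps t) G^T (Y t k k) (S t k k.+1)^T
    & fl_submulmx (eps t) (X t k.+1) (brow k.+1 (Q t)) (bcol k.+1 (S t) k.+1)
        (V t k.+1)].

Let res j t := X t j - (brow j (Q t) *m bcol j (Rb t) j + Q t j *m Rb t j j).

Let coercive_residual k : (k < p)%N -> (forall j, (j < k)%N -> res j <~ eM) ->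
  (forall j, (j < k)%N -> \forall t \near F, Rb t j j \in unitmx) ->
  \forall t \near F, forall (x : 'cV_s) (y : 'cV_(\sum_(i < k) s)),
    c / 2 * sg t * `|x| <= `|X t k *m x - brow k (Q t) *m y|.
Proof.
move=> kp resk Ru.
have [C C0 resC] : (fun t => \sum_(j < k) `|res j t|) <~ eM.
  by apply: dominated_sum => j _; apply: dominated_norm; exact: resk.
have c1 : 0 < c / 2 / (s%:R * C + 1) by rewrite !divr_gt0// ltr_wpDl// mulr_ge0.
have small : \forall t \near F, s%:R * (C * (eps t * M t)) <= c / 2 * sg t.
  apply: filterS2 eM_ge0 (regime_small1 c1) => t e0.
  by rewrite mulrAC ler_pdivlMr; [lra|rewrite ltr_wpDl// mulr_ge0].
have {}Ru : \forall t \near F, forall j : 'I_k, Rb t j j \in unitmx.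
  by apply: filter_forall => j; exact: Ru.
near=> t => x y.
have [_ _ s0 _] : [/\ 0 < eps t, eps t <= 1, 0 < sg t & sg t <= M t].
  by near: t; exact: regimeP.
have Rut : forall j : 'I_k, Rb t j j \in unitmx by near: t.
have resCt : `|\sum_(j < k) `|res j t| | <= C * (eps t * M t) by near: t.
have smallt : s%:R * (C * (eps t * M t)) <= c / 2 * sg t by near: t.
have Xc : forall (w : nat -> 'cV[R]_s) l, (l < p)%N ->
  c * sg t * `|w l| <= `|\sum_(j < p) X t j *m w j| by near: t.
pose yb i := if insub i is Some i' then submxcol y i' else 0.
have -> : brow k (Q t) *m y = \sum_(i < k) Q t i *m yb i.
  rewrite -{1}(submxcolK y) mul_mxrow_mxcol; apply: eq_bigr => i _.
  by rewrite /yb valK.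
have [z ->] := block_back_substitution (Q t) yb
  (fun j (jk : (j < k)%N) => Rut (Ordinal jk)).
(* The coefficient vector holds both x and the unknown z, so [X_coercive] bounds them together by
   the norm B0 of the combination. *)
pose w j := if (j < k)%N then - z j else if j == k then x else 0.
set B := `|_ - _|; pose B0 := `|\sum_(j < p) X t j *m w j|.
have XwE : \sum_(j < p) X t j *m w j = X t k *m x - \sum_(j < k) X t j *m z j.
  have -> : \sum_(j < p) X t j *m w j = \sum_(j < k.+1) X t j *m w j.
    rewrite (big_ord_widen p (fun j => X t j *m w j) kp) [RHS]big_mkcond/=.
    apply: eq_bigr => j _; case: ltnP => // kj.
    by rewrite /w ltnNge (ltnW kj)/= gtn_eqF// mulmx0.
  rewrite big_ord_recr/= /w ltnn eqxx addrC -sumrN; congr (_ + _).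
  by apply: eq_bigr => j _; rewrite ltn_ord mulmxN.
have B0B : B0 <= B + s%:R * \sum_(j < k) `|res j t| * `|z j|.
  rewrite /B0 XwE.
  have -> : X t k *m x - \sum_(j < k) X t j *m z j =
     (X t k *m x - \sum_(j < k) (brow j (Q t) *m bcol j (Rb t) j + Q t j *m Rb t j j) *m z j)
     - \sum_(j < k) res j t *m z j.
    rewrite -[RHS]addrA -opprD -big_split/=; congr (_ - _); apply: eq_bigr => j _.
    by rewrite -mulmxDl /res [_ + (_ - _)]addrC subrK.
  apply: le_trans (ler_normB _ _) _; rewrite lerD2l mulr_sumr.
  apply: le_trans (ler_norm_sum _ _ _) _; apply: ler_sum => j _.
  by rewrite mulrA; exact: mx_norm_mul.
have zB j : (j < k)%N -> c * sg t * `|z j| <= B0.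
  move=> jk; apply: le_trans (Xc w j (ltn_trans jk kp)).
  by rewrite /w jk normrN.
have xB : c * sg t * `|x| <= B0.
  by apply: le_trans (Xc w k kp); rewrite /w ltnn eqxx.
have csg : 0 < c * sg t by rewrite mulr_gt0.
have B00 : 0 <= B0 by exact: normr_ge0.
(* As z is bounded by B0 / (c sg), the residuals contribute at most B0 / 2, whence B0 <= 2 B. *)
have sumB : c * sg t * (s%:R * \sum_(j < k) `|res j t| * `|z j|) <= c / 2 * sg t * B0.
  apply: (@le_trans _ _ (s%:R * (C * (eps t * M t)) * B0)); last by rewrite ler_wpM2r.
  rewrite mulrCA -[leRHS]mulrA ler_wpM2l//.
  apply: (@le_trans _ _ (\sum_(j < k) `|res j t| * B0)).
    by rewrite mulr_sumr; apply: ler_sum => j _; rewrite mulrCA ler_wpM2l// zB.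
  by rewrite -mulr_suml ler_wpM2r// (le_trans _ resCt)// ler_norm.
have : B0 <= 2 * B.
  have : c * sg t * B0 <= c * sg t * (2 * B).
    have := ler_wpM2l (ltW csg) B0B; rewrite mulrDr.
    move=> /le_trans/(_ (lerD (lexx _) sumB)); lra.
  by rewrite ler_pM2l.
lra.
Unshelve. all: by end_near. Qed.

(** Blocks below k are finished. The last clause records the first pass of block k, which the loop
    performs while finishing the preceding block. *)
Let invariant k :=
  [/\ forall i j, (i < k)%N -> (j < k)%N ->
        (fun t => (Q t i)^T *m Q t j - (i == j)%:R%:M) <~ k2,
      forall j, (j < k)%N -> res j <~ eM,
      forall j, (j < k)%N -> \forall t \near F, Rb t j j \in unitmx
    & (k < p)%N ->
      (forall i, (i < k)%N -> (fun t => S t i k - (Q t i)^T *m X t k) <~ k1) /\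
      (fun t => V t k - (X t k - brow k (Q t) *m bcol k (S t) k)) <~ eM].

Let orthonormal_dominated k : invariant k ->
  (fun t => (brow k (Q t))^T *m brow k (Q t) - 1%:M) <~ k2.
Proof. by move=> [QQ _ _ _]; apply: dominated_gram_brow QQ; exact: k2_ge0. Qed.

Let eM1 : (fun t => eps t * (1 * M t)) <~ eM.
Proof. by apply: dominated_scale_eq => [|t _ _]; [exact: eM_ge0|rewrite mul1r]. Qed.

Let eMM : (fun t => eps t * (M t * M t)) <~ eM2.
Proof. by apply: dominated_scale_eq => [|t _ _]; [exact: eM2_ge0|rewrite expr2]. Qed.

Let invariant1 : (0 < p)%N -> invariant 1.
Proof.
move=> p0.
have res0 j : (j < 1)%N -> res j <~ eM.
  case: j => // _; apply: dominated_eq X0 => t.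
  by rewrite /res brow_bcol big_ord0 add0r.
(* On a kernel vector of R_00, X_0 would act as its residual O(eps M), against coercivity of order
   sg. *)
have R0u j : (j < 1)%N -> \forall t \near F, Rb t j j \in unitmx.
  case: j => // _; have c2 : 0 < c / 2 by rewrite divr_gt0.
  have [C C0 X0C] := X0; have c1 : 0 < c / 2 / (s%:R * C + 1).
    by rewrite !divr_gt0// ltr_wpDl// mulr_ge0.
  apply: filterS3 (filterI eM_ge0 X_coercive) X0C (filterI regimeP (regime_small1 c1)).
  move=> t [e0 Xc] X0t [[_ _ s0 _] sm]; apply: unitmx_of_ker0 => x Rx.
  have := Xc (fun j => if j == 0%N then x else 0) 0%N p0; rewrite eqxx.
  have -> : \sum_(j < p) X t j *m (if j == 0%N :> nat then x else 0) =
      (X t 0%N - Q t 0%N *m Rb t 0%N 0%N) *m x.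
    rewrite mulmxBl -mulmxA Rx mulmx0 subr0 (bigD1 (Ordinal p0))//= big1 ?addr0// => i.
    by rewrite -val_eqE/= => /negbTE->; rewrite mulmx0.
  move=> /le_trans/(_ (mx_norm_mul _ _)) cx.
  have : c * sg t * `|x| <= c / 2 * sg t * `|x|.
    apply: le_trans cx _; rewrite ler_wpM2r//.
    apply: (@le_trans _ _ (s%:R * (C * (eps t * M t)))); first by rewrite ler_wpM2l.
    by move: sm; rewrite mulrAC ler_pdivlMr; [lra|rewrite ltr_wpDl// mulr_ge0].
  have csg : 0 < c * sg t by rewrite mulr_gt0.
  move=> cx2; have : c * sg t * `|x| <= 0 by lra.
  by rewrite pmulr_rle0// normr_le0 => /eqP.
have Q01 : (fun t => Q t 0%N) <~ (fun=> 1) by exact: dominated_near_orthogonal.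
split=> // [[]//[]// _ _|p1].
have SX : (fun t => S t 0%N 1%N - (Q t 0%N)^T *m X t 1%N) <~ eM.
  apply: dominated_trans eM1.
  apply: dominated_fl_mulmx; first by move=> t; case: (first t p1).
    exact: dominated_trmx.
  exact: XM.
split.
  by case=> // _; exact: dominated_trans SX eM_le_k1.
have SM : (fun t => S t 0%N 1%N) <~ M.
  have Q0X : (fun t => (Q t 0%N)^T *m X t 1%N) <~ M.
    apply: dominated_mulmx_le (dominated_trmx Q01) (XM p1) _.
    by apply: dominated_scale_eq => [|t _ _]; [exact: M_ge0|rewrite mul1r].
  have SX' : (fun t => S t 0%N 1%N - (Q t 0%N)^T *m X t 1%N) <~ M.
    apply: dominated_trans SX _; apply: dominated_trans eM_le_k1 _.
    exact: dominated_trans k1_le_sg sg_le_M.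
  by apply: dominated_eq (dominatedD SX' Q0X) => t; rewrite subrK.
have VE := dominated_fl_submulmx (fun t => (first t p1).2) (XM p1) Q01 SM.
apply: dominated_eq (VE _) => [t|]; last first.
  by apply: dominated_scale_eq => [|t _ _]; [exact: M_ge0|rewrite mul1r].
by rewrite brow_bcol big_ord1.
Qed.

Let invariantS k : (0 < k)%N -> (k < p)%N -> invariant k -> invariant k.+1.
Proof.
move=> k0 kp inv; have [QQ resk Ru /(_ kp)[SX VX]] := inv.
have orthA := orthonormal_dominated inv.
have c2 : 0 < c / 2 by rewrite divr_gt0.
have coer := coercive_residual kp resk Ru.
have bSX : (fun t => bcol k (S t) k - (brow k (Q t))^T *m X t k) <~ k1.
  apply: (@dominated_eq _ _ _ _ _ _ (fun t =>
      bcol k (fun i j => S t i j - (Q t i)^T *m X t j) k)).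
    by move=> t; rewrite tr_brow_mul /bcol -mxcolB.
  by apply: dominated_bcol => //; exact: k1_ge0.
have A1 : (fun t => brow k (Q t)) <~ (fun=> 1) by exact: dominated_near_orthogonal.
have VM := first_pass_bound orthA (XM kp) bSX VX.
have YV : (fun t => bcol k (Y t) k - (brow k (Q t))^T *m V t k) <~ eM.
  apply: dominated_trans eM1.
  by apply: dominated_fl_batch A1 VM => t; have [YE _ _] := second t k0 kp; exact: YE.
have OmV : (fun t => Om t k - (V t k)^T *m V t k) <~ eM2.
  apply: dominated_trans eMM.
  by apply: (dominated_fl_batch _ VM VM) => t; have [_ OmE _] := second t k0 kp; exact: OmE.
(* Intermediate results exist run by run; choice makes them functions of t so that they can be
   dominated. *)
have /choice[G GE] : forall t, exists G,
    fl_submulmx (eps t) (Om t k) (bcol k (Y t) k)^T (bcol k (Y t) k) G /\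
    fl_chol (eps t) G (Y t k k).
  by move=> t; case: (second t k0 kp) => _ _ [[G GE UE] _ _ _]; exists G.
have /choice[W WE] : forall t, exists W,
    fl_submulmx (eps t) (V t k) (brow k (Q t)) (bcol k (Y t) k) W /\
    fl_trsm (eps t) W (Y t k k) (Q t k).
  by move=> t; case: (second t k0 kp) => _ _ [_ [W WE QE] _ _]; exists W.
have RbE t : fl_addmx (eps t) (bcol k (S t) k) (bcol k (Y t) k) (bcol k (Rb t) k).
  by case: (second t k0 kp) => _ _ [].
have RY t : Rb t k k = Y t k k by case: (second t k0 kp) => _ _ [].
have [resXk AQ QQk Uu] := reorthogonalization_stable c2 orthA (XM kp) coer bSX VX YV OmV
  (fun t => (WE t).1) (fun t => (GE t).1) (fun t => (GE t).2) (fun t => (WE t).2) RbE.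
have AQi i : (i < k)%N -> (fun t => (Q t i)^T *m Q t k) <~ k2.
  move=> ik; apply: (@dominated_bcol_coef _ k (fun t i _ => (Q t i)^T *m Q t k) 0) => //.
    exact: k2_ge0.
  by apply: dominated_eq AQ => t; rewrite tr_brow_mul.
have QQS i j : (i < k.+1)%N -> (j < k.+1)%N ->
    (fun t => (Q t i)^T *m Q t j - (i == j)%:R%:M) <~ k2.
  rewrite !ltnS (leq_eqVlt i) (leq_eqVlt j) => /predU1P[->|ik] /predU1P[->|jk].
  - by apply: dominated_eq QQk => t; rewrite eqxx.
  - apply: dominated_eq (dominated_trmx (AQi _ jk)) => t.
    by rewrite gtn_eqF// raddf0 subr0 trmx_mul trmxK.
  - by apply: dominated_eq (AQi _ ik) => t; rewrite ltn_eqF// raddf0 subr0.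
  - exact: QQ.
split=> [//|j|j|k1p].
- rewrite ltnS leq_eqVlt => /predU1P[->|]; last exact: resk.
  by apply: dominated_eq resXk => t; rewrite /res RY.
- rewrite ltnS leq_eqVlt => /predU1P[->|]; last exact: Ru.
  by apply: filterS Uu => t; rewrite RY.
have ZX : (fun t => bcol k (S t) k.+1 - (brow k (Q t))^T *m X t k.+1) <~ eM.
  apply: dominated_trans eM1.
  apply: dominated_fl_batch A1 (XM k1p) => t.
  by have [ZE _ -> _ _] := next t k0 k1p; exact: ZE.
have PX : (fun t => P t k - (V t k)^T *m X t k.+1) <~ eM2.
  apply: dominated_trans eMM.
  by apply: dominated_fl_batch VM (XM k1p) => t; have [_ PE _ _ _] := next t k0 k1p; exact: PE.
have /choice[G' G'E] : forall t, exists G',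
    fl_submulmx (eps t) (P t k) (bcol k (Y t) k)^T (bcol k (S t) k.+1) G' /\
    fl_trsm (eps t) G'^T (Y t k k) (S t k k.+1)^T.
  by move=> t; case: (next t k0 k1p) => _ _ -> [G' ? ?] _; exists G'.
have SXk := next_first_pass_coef c2 orthA (XM kp) coer bSX VX YV OmV
  (fun t => (WE t).1) (fun t => (GE t).1) (fun t => (GE t).2) (fun t => (WE t).2)
  (XM k1p) ZX PX (fun t => (G'E t).1) (fun t => (G'E t).2).
have SXS i : (i < k.+1)%N -> (fun t => S t i k.+1 - (Q t i)^T *m X t k.+1) <~ k1.
  rewrite ltnS leq_eqVlt => /predU1P[->//|ik].
  apply: (@dominated_bcol_coef _ k (fun t i j => S t i j - (Q t i)^T *m X t j)) => //.
    exact: k1_ge0.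
  apply: dominated_eq (dominated_trans ZX eM_le_k1) => t.
  by rewrite tr_brow_mul /bcol -mxcolB.
split=> //.
have QS1 : (fun t => brow k.+1 (Q t)) <~ (fun=> 1).
  apply: dominated_near_orthogonal; apply: dominated_gram_brow => //; exact: k2_ge0.
have bSXS : (fun t => bcol k.+1 (S t) k.+1 - (brow k.+1 (Q t))^T *m X t k.+1) <~ k1.
  apply: (@dominated_eq _ _ _ _ _ _ (fun t =>
      bcol k.+1 (fun i j => S t i j - (Q t i)^T *m X t j) k.+1)).
    by move=> t; rewrite tr_brow_mul /bcol -mxcolB.
  by apply: dominated_bcol => //; exact: k1_ge0.
have SM := first_pass_coef_bound (dominated_gram_brow k2_ge0 QQS) (XM k1p) bSXS.
apply: dominated_fl_submulmx (XM k1p) QS1 SM _ => [t|].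
  by case: (next t k0 k1p).
by apply: dominated_scale_eq => [|t _ _]; [exact: M_ge0|rewrite mul1r].
Qed.

Lemma bcgsiA1S_stable : (0 < p)%N ->
  (fun t => (brow p (Q t))^T *m brow p (Q t) - 1%:M) <~ k2 /\
  forall j, (j < p)%N -> (fun t => X t j -
    (brow j (Q t) *m bcol j (Rb t) j + Q t j *m Rb t j j)) <~ eM.
Proof.
move=> p0; suff inv q : (0 < q)%N -> (q <= p)%N -> invariant q.
  have [_ resp _ _] := inv p p0 (leqnn p).
  by split=> //; apply: orthonormal_dominated; exact: inv.
elim: q => // -[|k] IH _ kp; first exact: invariant1.
by apply: invariantS => //; apply: IH => //; exact: ltnW.
Qed.

End Run.

End Regime.

(** * Coercivity of the block row and the assumption on IO_A for the first block *)

Section FirstBlock.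
Context {R : realType}.
Variables (m s p : nat) (X : nat -> 'M[R]_(m, s)).
Hypotheses (s_gt0 : (0 < s)%N) (p_gt0 : (0 < p)%N).

Lemma sum_dims_gt0 : (0 < \sum_(j < p) s)%N.
Proof. by rewrite sum_nat_const card_ord muln_gt0 p_gt0. Qed.

Lemma norm2_brow_mul (w : nat -> 'cV[R]_s) l : (l < p)%N ->
  sigma_min (brow p X) * `|w l| <= m%:R * `|\sum_(j < p) X j *m w j|.
Proof.
move=> lp; rewrite -(mul_mxrow_mxcol X (fun i => w i)).
apply: le_trans (norm2_le_mx_norm _); apply: le_trans (sigma_min_le _ sum_dims_gt0 _).
rewrite ler_wpM2l ?sigma_min_ge0 ?sum_dims_gt0//.
apply: le_trans (mx_norm_le_norm2 _); apply: mx_norm_le => // i j.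
have := mx_norm_coef (\mxcol_(i < p) w i) (tagnat.Rank (Ordinal lp) i) j.
have /matrixP/(_ i j) := mxcolK (fun i : 'I_p => w i) (Ordinal lp).
by rewrite [LHS]mxE => ->.
Qed.

(** Padding by zeros is isometric; hence the singular values of X_1 lie between the extreme ones of
    the block row. *)
Lemma brow_first_block (x : 'cV[R]_s) :
  exists2 w, brow p X *m w = X 0%N *m x & norm2 w = norm2 x.
Proof.
pose y (i : 'I_p) := if i == Ordinal p_gt0 then x else 0.
exists (\mxcol_(i < p) y i).
  rewrite mul_mxrow_mxcol (bigD1 (Ordinal p_gt0))//= /y eqxx big1 ?addr0// => i i0.
  by rewrite (negbTE i0) mulmx0.
apply: (@pexpIrn _ 2) => //; rewrite ?nnegrE ?norm2_ge0// !sqr_norm2.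
rewrite tr_mxcol mul_mxrow_mxcol (bigD1 (Ordinal p_gt0))//= /y eqxx big1 ?addr0// => i i0.
by rewrite (negbTE i0) mulmx0.
Qed.

Lemma opnorm2_first_block : opnorm2 (X 0%N) <= opnorm2 (brow p X).
Proof.
apply: opnorm2_le => [|x]; first exact: opnorm2_ge0.
by have [w <- <-] := brow_first_block x; exact: norm2_mul_opnorm2.
Qed.

Lemma sigma_min_first_block : sigma_min (brow p X) <= sigma_min (X 0%N).
Proof.
apply: le_sigma_min => // x.
by have [w <- <-] := brow_first_block x; apply: sigma_min_le; exact: sum_dims_gt0.
Qed.

Hypothesis sigma_gt0 : 0 < sigma_min (brow p X).

Lemma kappa_brow : kappa (brow p X) = (opnorm2 (brow p X) / sigma_min (brow p X))%:E.
Proof. by rewrite kappaE ?sum_dims_gt0// gt_eqF. Qed.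

Let sigma0_gt0 : 0 < sigma_min (X 0%N).
Proof. exact: lt_le_trans sigma_min_first_block. Qed.

Lemma kappa_first_block : kappa (X 0%N) = (opnorm2 (X 0%N) / sigma_min (X 0%N))%:E.
Proof. by rewrite kappaE// gt_eqF. Qed.

Lemma kappa_first_block_le : (kappa (X 0%N) <= kappa (brow p X))%E.
Proof.
rewrite kappa_brow kappa_first_block lee_fin ler_pM ?invr_ge0 ?opnorm2_ge0//.
- exact: ltW.
- exact: opnorm2_first_block.
- by rewrite lef_pV2 ?posrE// sigma_min_first_block.
Qed.

Lemma kappa_brow_ge1 : 1 <= opnorm2 (brow p X) / sigma_min (brow p X).
Proof. by rewrite ler_pdivlMr// mul1r sigma_min_le_opnorm2// sum_dims_gt0. Qed.

(** The exponent is raised to 2 only after passing to the condition number of the whole block row,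
    which is at least 1. *)
Lemma first_block_orthonormal (Q : 'M[R]_(m, s)) (e alpha : R) :
  0 <= alpha -> alpha <= 2 ->
  ((opnorm2 (1%:M - Q^T *m Q))%:E <= e%:E * (kappa (X 0%N) `^ alpha))%E ->
  `|Q^T *m Q - 1%:M| <=
    `|e| * (opnorm2 (brow p X) / sigma_min (brow p X)) ^+ 2.
Proof.
move=> a0 a2; rewrite kappa_first_block poweR_EFin -EFinM lee_fin => oQ.
rewrite distrC (le_trans (mx_norm_le_opnorm2 _))// (le_trans oQ)//.
apply: (@le_trans _ _ (`|e| * (opnorm2 (X 0%N) / sigma_min (X 0%N)) `^ alpha)).
  by rewrite ler_wpM2r ?powR_ge0// ler_norm.
have k1 := kappa_brow_ge1.
rewrite ler_wpM2l// -powR_mulrn ?(le_trans ler01 k1)//.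
apply: le_trans (ler_powR k1 a2).
have := kappa_first_block_le; rewrite kappa_brow kappa_first_block lee_fin => kk.
apply: ge0_ler_powR => //; rewrite nnegrE ?(le_trans ler01 k1)//.
by rewrite divr_ge0 ?opnorm2_ge0// ltW.
Qed.

End FirstBlock.

(* A computed run together with the input of the asymptotic analysis.  The
   constants of theorem5 are obtained by letting the run vary along the
   filter of the condition eps kappa^3 -> 0. *)
Record run (R : realType) (m s p : nat) (cB cR cO : R) := Run {
  run_eps : R;
  run_X : nat -> 'M[R]_(m, s);
  run_Q : nat -> 'M[R]_(m, s);
  run_R : nat -> nat -> 'M[R]_s;
  run_eps_gt0 : 0 < run_eps;
  run_sigma_gt0 : 0 < sigma_min (brow p run_X);
  run_first_residual : `|run_X 0%N - run_Q 0%N *m run_R 0%N 0%N| <=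
    cR * (run_eps * opnorm2 (brow p run_X));
  run_first_orthonormal : `|(run_Q 0%N)^T *m run_Q 0%N - 1%:M| <=
    cO * (run_eps * opnorm2 (brow p run_X) ^+ 2 / sigma_min (brow p run_X) ^+ 2);
  run_computed : exists IOA, bcgsiA1S run_eps cB IOA p run_X run_Q run_R
}.

(** * Uniform constants from the filter on runs *)

Section RunBounds.
Context {R : realType} {m s p : nat} {cB cR cO : R}.
Hypotheses (m_gt0 : (0 < m)%N) (s_gt0 : (0 < s)%N) (p_gt0 : (0 < p)%N).
Hypotheses (cR_ge0 : 0 <= cR) (cO_ge0 : 0 <= cO).
Local Notation run := (run m s p cB cR cO).

Let eps (t : run) := run_eps t.
Let M (t : run) := opnorm2 (brow p (run_X t)).
Let sg (t : run) := sigma_min (brow p (run_X t)).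

(** The base sets are eps kappa^3 <= c. Dimensions and [cB], [cR], [cO] are parameters of the type
    of runs, so constants found along this filter depend on nothing else. *)
Definition run_filter : set_system run :=
  filter_from [set c : R | 0 < c] (fun c => [set t | eps t * M t ^+ 3 <= c * sg t ^+ 3]).

Instance run_filter_filter : Filter run_filter.
Proof.
apply: filter_from_filter; first by exists 1; rewrite /= ltr01.
move=> c d /= c0 d0; exists (Num.min c d); first by rewrite /= lt_min c0.
have sg0 (t : run) : 0 < sg t ^+ 3 by rewrite exprn_gt0 ?run_sigma_gt0.
move=> t /= te; split; apply: le_trans te _; rewrite ler_pM2r//.
  by rewrite ge_min lexx.
by rewrite ge_min lexx orbT.
Qed.

Lemma run_regime : regime run_filter eps M sg.
Proof.
split.
  apply: nearW => t; split; [exact: run_eps_gt0|exact: run_sigma_gt0|].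
  by apply: sigma_min_le_opnorm2; exact: sum_dims_gt0.
by move=> c c0; exists c.
Qed.

Lemma run_bounds :
  dominated run_filter
    (fun t => (brow p (run_Q t))^T *m brow p (run_Q t) - 1%:M)
    (fun t => eps t * M t ^+ 2 / sg t ^+ 2) /\
  dominated run_filter
    (fun t => brow p (run_Q t) *m bmx p (run_R t) - brow p (run_X t))
    (fun t => eps t * M t).
Proof.
have /choice[IOA] := @run_computed R m s p cB cR cO.
move=> /choice[V /choice[Om /choice[P /choice[S /choice[Y /choice[Z alg]]]]]].
have c0 : 0 < m%:R^-1 :> R by rewrite invr_gt0 ltr0n.
have [|||||||orth res] := @bcgsiA1S_stable _ _ _ _ _ _ _ run_regime m s p cB m%:R^-1
  (@run_X _ _ _ _ _ _ _) (@run_Q _ _ _ _ _ _ _) V Om P S Y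
  (@run_R _ _ _ _ _ _ _) Z c0 _ _ _ _ _ _ _ p_gt0.
- move=> j jp; exists 1 => //; apply: nearW => t; rewrite mul1r.
  apply: le_trans (mx_norm_le_opnorm2 _); apply: mx_norm_le => // a b.
  have := mx_norm_coef (brow p (run_X t)) a (tagnat.Rank (Ordinal jp) b).
  have /matrixP/(_ a b) := mxrowK (fun j : 'I_p => run_X t j) (Ordinal jp).
  by rewrite [LHS]mxE => ->.
- apply: nearW => t w l lp.
  have := norm2_brow_mul (run_X t) s_gt0 p_gt0 w lp.
  by rewrite -ler_pdivrMl ?ltr0n// mulrA.
- by exists cR => //; apply: nearW => t; exact: run_first_residual.
- by exists cO => //; apply: nearW => t; exact: run_first_orthonormal.
- by move=> t p1; have [_ /(_ p1)] := alg t.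
- move=> t k k0 kp; have [_ _ loop last _] := alg t.
  move: kp; rewrite leq_eqVlt => /predU1P[kp|kp]; first exact: last.
  by have [[]] := loop k k0 kp.
- move=> t k k0 kp; have [_ _ loop last _] := alg t.
  by have [[? ? ? ?] _ [? ?] ?] := loop k k0 kp; split.
split=> //.
have eM0 : \forall t \near run_filter, 0 <= eps t * M t.
  by apply: nearW => t; rewrite mulr_ge0 ?opnorm2_ge0// ltW// run_eps_gt0.
pose D (t : run) j := - (run_X t j -
  (brow j (run_Q t) *m bcol j (run_R t) j + run_Q t j *m run_R t j j)).
apply: (@dominated_eq _ _ _ _ _ _ (fun t => brow p (D t))) => [t|]; last first.
  by apply: dominated_brow => // j jp; apply: dominatedN; exact: res.
(* Vanishing blocks below the diagonal of R reduce a block column of the product to the sum up to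
   j. *)
have [_ _ _ _ Rup] := alg t.
rewrite /bmx /brow mul_mxrow_mxblock -mxrowB; apply: eq_mxrow => j.
rewrite /D opprB; congr (_ - _); rewrite brow_bcol.
rewrite (big_ord_widen p (fun i => run_Q t i *m run_R t i j) (ltnW (ltn_ord j))).
rewrite (bigID (fun i : 'I_p => (i < j)%N))/=; congr (_ + _).
rewrite (bigD1 j) ?ltnn//= big1 ?addr0// => i; rewrite -leqNgt => /andP[ji ij].
by rewrite Rup ?mulmx0// ltn_ord andbT ltn_neqAle ji andbT eq_sym; exact: ij.
Qed.

End RunBounds.

Theorem theorem5 (R : realType) (m s p : nat)
    (m_gt0 : (0 < m)%N) (s_gt0 : (0 < s)%N) (p_gt0 : (0 < p)%N)
    (le_ps_m : (p * s <= m)%N)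
    (* the constants hidden in the O(eps) of the assumptions *)
    (cB cR cO : R) :
  exists cK cR' cO' : R,
    [/\ 0 < cK, 0 < cR' & 0 < cO'] /\
    forall (eps : R) (alphaA : R)
        (IOA : 'M[R]_(m, s) -> 'M[R]_(m, s) * 'M[R]_s)
        (X Q : nat -> 'M[R]_(m, s)) (Rb : nat -> nat -> 'M[R]_s),
      0 < eps ->
      0 <= alphaA ->
      (forall A : 'M[R]_(m, s), (kappa A <= kappa (brow p X))%E ->
        let: (QA, RA) := IOA A in
        (exists DA : 'M[R]_(m, s),
          A + DA = QA *m RA /\ opnorm2 DA <= cR * eps * opnorm2 A) /\
        ((opnorm2 (1%:M - QA^T *m QA))%:E
           <= (cO * eps)%:E * (kappa A `^ alphaA))%E) ->
      bcgsiA1S eps cB IOA p X Q Rb ->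
      alphaA <= 2 ->
      ((cK * eps)%:E * kappa (brow p X) ^+ 3 <= (1 / 2 : R)%:E)%E ->
      (exists DX : 'M[R]_(m, \sum_(j < p) s),
        brow p X + DX = brow p Q *m bmx p Rb /\
        opnorm2 DX <= cR' * eps * opnorm2 (brow p X)) /\
      ((opnorm2 (1%:M - (brow p Q)^T *m brow p Q))%:E
         <= (cO' * eps)%:E * kappa (brow p X) ^+ 2)%E.
Proof.

(* [cR] and [cO] may be negative; their absolute values are weaker bounds of the required sign. *)
have [orth resid] := run_bounds (cB := cB) m_gt0 s_gt0 p_gt0 (normr_ge0 cR) (normr_ge0 cO).
have [C1 C10 [c1 /= c1_gt0 bound1]] := orth.
have [C2 C20 [c2 /= c2_gt0 bound2]] := resid.
pose c := Num.min c1 c2.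
have c_gt0 : 0 < c by rewrite lt_min c1_gt0.
pose r := (\sum_(j < p) s)%N.
(* The first constant turns the bound 1 / 2 of the hypothesis into eps kappa^3 <= c. The factors of
   the dimensions convert max norms into operator norms, and + 1 makes the constants positive. *)
exists (1 / (2 * c)), (m%:R * r%:R * C2 + 1), (r%:R * r%:R * C1 + 1); split.
  by split; rewrite ?divr_gt0 ?mulr_gt0// ltr_wpDl// mulr_ge0// mulr_ge0.
move=> eps alphaA IOA X Q Rb eps_gt0 alpha0 IOA_stable alg alpha2 small.
(* A rank-deficient input has kappa = +oo, which the smallness hypothesis excludes. *)
have [sigma0|sigma0] := eqVneq (sigma_min (brow p X)) 0.
  move: small; rewrite kappaE ?sum_dims_gt0// sigma0 eqxx.
  have cK : 0 < 1 / (2 * c) * eps by rewrite mulr_gt0// divr_gt0// mulr_gt0.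
  by rewrite !mulyy gt0_muley ?lte_fin// leye_eq.
have sigma_gt0 : 0 < sigma_min (brow p X).
  by rewrite lt_def sigma0 sigma_min_ge0// sum_dims_gt0.
have := IOA_stable (X 0%N) (kappa_first_block_le s_gt0 p_gt0 sigma_gt0).
have [V [Om [P [S [Y [Z [IOA0 _ _ _ _]]]]]]] := alg.
rewrite IOA0 => -[[DA [XDA DAle]] orth0].
have res0 : `|X 0%N - Q 0%N *m Rb 0%N 0%N| <= `|cR| * (eps * opnorm2 (brow p X)).
  rewrite -XDA opprD addNKr normrN mulrA; apply: le_trans (mx_norm_le_opnorm2 _) _.
  apply: le_trans DAle _.
  apply: (@le_trans _ _ (`|cR| * eps * opnorm2 (X 0%N))).
    by rewrite ler_wpM2r ?opnorm2_ge0// ler_pM2r// ler_norm.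
  by rewrite ler_wpM2l ?opnorm2_first_block// mulr_ge0// ltW.
have ort0 : `|(Q 0%N)^T *m Q 0%N - 1%:M| <= `|cO| *
    (eps * opnorm2 (brow p X) ^+ 2 / sigma_min (brow p X) ^+ 2).
  apply: le_trans (first_block_orthonormal s_gt0 p_gt0 sigma_gt0 alpha0 alpha2 orth0) _.
  by rewrite normrM (gtr0_norm eps_gt0) expr_div_n !mulrA.
pose t := Run eps_gt0 sigma_gt0 res0 ort0 (ex_intro _ IOA alg).
have eM3 : eps * opnorm2 (brow p X) ^+ 3 <= c * sigma_min (brow p X) ^+ 3.
  move: small; rewrite kappa_brow// -!EFinM lee_fin.
  set k := opnorm2 _ / _ => small.
  have -> : opnorm2 (brow p X) = k * sigma_min (brow p X) by rewrite divfK.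
  rewrite exprMn mulrA ler_pM2r ?exprn_gt0// (_ : k ^+ 3 = k * (k * k)); last by ring.
  have -> : eps * (k * (k * k)) = 2 * c * (1 / (2 * c) * eps * (k * (k * k))).
    by field; rewrite gt_eqF.
  apply: (@le_trans _ _ (2 * c * (1 / 2))); last by lra.
  by rewrite ler_pM2l// mulr_gt0.
have {bound1} := bound1 t (le_trans eM3 _); have {bound2} := bound2 t (le_trans eM3 _).
rewrite /= !ler_pM2r ?exprn_gt0// !ge_min !lexx orbT.
move=> /(_ isT) bound2 /(_ isT) bound1.
split.
  exists (brow p Q *m bmx p Rb - brow p X); rewrite addrC subrK; split=> //.
  apply: le_trans (opnorm2_le_mx_norm _) _; rewrite -/r.
  have := ler_wpM2l (mulr_ge0 (ler0n R m) (ler0n R r)) bound2 => /le_trans; apply.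
  have := mulr_ge0 (ltW eps_gt0) (opnorm2_ge0 (brow p X)); lra.
rewrite kappa_brow// -!EFinM lee_fin.
apply: le_trans (opnorm2_le_mx_norm _) _; rewrite distrC -/r.
have := ler_wpM2l (mulr_ge0 (ler0n R r) (ler0n R r)) bound1 => /le_trans; apply.
set k := opnorm2 _ / _.
have -> : opnorm2 (brow p X) = k * sigma_min (brow p X) by rewrite divfK.
have -> : eps * (k * sigma_min (brow p X)) ^+ 2 / sigma_min (brow p X) ^+ 2 = eps * (k * k).
  by field.
have := mulr_ge0 (ltW eps_gt0) (sqr_ge0 k); rewrite expr2; lra.
Qed.
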